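(* Let $m\ge 1$, let $S=\mathbb{C}[x_1,\dots,x_m]$ with the standard grading, and let $$\Theta:\quad 0\to F_1\xrightarrow{D_1} G_1\xrightarrow{E_1} F_2\xrightarrow{D_2} G_2\xrightarrow{E_2}\cdots\to F_n\xrightarrow{D_n} G_n\to 0$$ be a chain complex of finitely generated graded free $S$-modules with degree-preserving differentials, whose homology modules are all artinian (i.e. of finite length). Choose homogeneous bases; let $v_{j,1},\dots,v_{j,a_j}$ be the degrees of the basis elements of $F_j$ and $w_{j,1},\dots,w_{j,b_j}$ the degrees of the basis elements of $G_j$. Let $1\le q\le n$, let $r_q$ be the rank of $E_q$ (with $E_n:G_n\to 0$, so that $r_n=0$), let $\vec v_q$ denote the vector of all integers $v_{j,k}$ with $j\le q$, and let $\vec w_q$ denote the vector of all integers $w_{j,k}$ with $j\le q$. Put $u_0=1$, let $u_1,\dots,u_{r_q}$ be the integers defined recursively by $$\sigma_i(\vec w_q)=\sum_{j=0}^{i}\sigma_j(\vec v_q)\,u_{i-j},\qquad 1\le i\le r_q,$$ and let $u_j=0$ for $j>r_q$. Then $$\sigma_i(\vec w_q)=\sum_{j=0}^{i}\sigma_j(\vec v_q)\,u_{i-j}\qquad\text{for } r_q+1\le i\le m-1.$$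
   Context: $\sigma_i$ denotes the $i$-th elementary symmetric function of the entries of a vector, with $\sigma_0=1$ and $\sigma_i=0$ when $i$ exceeds the number of entries. The rank of a homomorphism of free $S$-modules is its rank over the fraction field of $S$. *)

(* Defs.v *)
From mathcomp Require Export all_boot all_order all_algebra.
From mathcomp Require Export classical_sets reals complex.
From mathcomp Require Export mpoly.

Set Implicit Arguments.
Unset Strict Implicit.
Unset Printing Implicit Defensive.

Import Order.TTheory GRing.Theory Num.Theory.

Local Open Scope classical_set_scope.
Local Open Scope ring_scope.

(* Elements of a free module of rank k are row vectors over the ring, and a
   k x l matrix M is the homomorphism u |-> u *m M. *)
Section FreeModules.
Variable S : comNzRingType.

Definition kernel k l (M : 'M[S]_(k, l)) : set 'rV[S]_k :=
  [set u | u *m M = 0].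

Definition image_mod k l (M : 'M[S]_(k, l)) : set 'rV[S]_l :=
  [set u *m M | u in [set: 'rV[S]_k]].

Definition submodule k (N : set 'rV[S]_k) : Prop := submod_closed (mem N).

(* The module Z / B, for submodules B `<=` Z, satisfies the descending chain
   condition; its submodules are the N / B with B `<=` N `<=` Z.  For S noetherian this
   says that Z / B has finite length. *)
Definition artinian_quotient k (Z B : set 'rV[S]_k) : Prop :=
  forall N : nat -> set 'rV[S]_k,
    (forall i, [/\ submodule (N i), B `<=` N i & N i `<=` Z]) ->
    (forall i, N i.+1 `<=` N i) ->
    exists i0, forall i, (i0 <= i)%N -> N i = N i0.

Definition artinian_homology k l p (M : 'M[S]_(k, l)) (M' : 'M[S]_(l, p)) :=
  artinian_quotient (kernel M') (image_mod M).

End FreeModules.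

Section Graded.
Variables (K : fieldType) (m : nat).
Local Notation S := {mpoly K[m]}.

(* S has no nonzero element of negative degree *)
Definition homog_of_deg (d : int) (p : S) : Prop :=
  if d is Posz n then p \is n.-homog else p = 0.

(* The sequence e of integers stands for the graded free S-module with a
   homogeneous basis of degrees e`_0, e`_1, ...; these are the homogeneous
   elements of degree d in it. *)
Definition homog_vec (e : seq int) (d : int) (u : 'rV[S]_(size e)) : Prop :=
  forall k : 'I_(size e), homog_of_deg (d - e`_k) (u 0 k).

Definition degree_preserving (e e' : seq int)
    (M : 'M[S]_(size e, size e')) : Prop :=
  forall d u, @homog_vec e d u -> @homog_vec e' d (u *m M).

(* 0 -> F_1 -> G_1 -> F_2 -> ... -> F_n -> G_n -> 0.  All modules of index
   outside 1..n are zero, so that E_0 : 0 -> F_1 and E_n : G_n -> 0. *)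
Record graded_free_complex (n : nat) := GradedFreeComplex {
  fdeg : nat -> seq int;
  gdeg : nat -> seq int;
  mapD : forall j, 'M[S]_(size (fdeg j), size (gdeg j));
  mapE : forall j, 'M[S]_(size (gdeg j), size (fdeg j.+1));
  complex_support :
    forall j, ~~ (1 <= j <= n)%N -> fdeg j = [::] /\ gdeg j = [::];
  mapD_degree : forall j, degree_preserving (mapD j);
  mapE_degree : forall j, degree_preserving (mapE j);
  mapDE : forall j, mapD j *m mapE j = 0;
  mapED : forall j, mapE j *m mapD j.+1 = 0
}.

(* The first conjunct is the homology at G_j, the second one at F_(j+1). *)
Definition homology_artinian n (T : graded_free_complex n) : Prop :=
  forall j, artinian_homology (mapD T j) (mapE T j) /\
            artinian_homology (mapE T j) (mapD T j.+1).

Definition frac_rank k l (M : 'M[S]_(k, l)) : nat :=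
  \rank (map_mx (@tofrac S) M).

Definition fdegs_upto n (T : graded_free_complex n) (q : nat) : seq int :=
  flatten [seq fdeg T j | j <- iota 1 q].

Definition gdegs_upto n (T : graded_free_complex n) (q : nat) : seq int :=
  flatten [seq gdeg T j | j <- iota 1 q].

End Graded.

Definition sigma (i : nat) (s : seq int) : int :=
  (mesym (size s) int i).@[fun k => s`_k].

(* Main.v *)
(* On punctured affine space the complex is split exact, so its truncation
   0 -> F_1 -> ... -> G_q resolves a vector bundle of rank r, and the theorem says that the
   i-th Chern class of this bundle vanishes for r < i < m.  It is deduced from the vanishing
   of the i-th exterior power for i > r.  The differential extends to an odd derivation d of
   the superalgebra Sym(F) (x) Lambda(G), with F = F_1 + ... + F_q and G = G_1 + ... + G_q.
   A homotopy contracting x_k^N on the whole complex becomes, on the truncation, a homotopy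
   between x_k^N and an endomorphism P of G_q with P^2 = x_k^N P and rank at most r.  The
   derivation extending P has its eigenvalues among the j x_k^N with j <= r, whereas the one
   extending x_k^N is i x_k^N on words of length i.  Hence for i > r a power of every x_k is
   nullhomotopic there, and, as powers of the variables form a regular sequence, the part of
   length i is exact in large degrees.  Comparing dimensions, the coefficient of y^i in
   prod (1 - s^w y) / prod (1 - s^v y) is divisible by (1 - s)^m for all i > r.  The
   substitution y = z / (1 + z) turns 1 - s^w y into 1 + (1 - s^w) z up to a factor 1 + z, and
   the leading terms in tau = 1 - s give the relations between the elementary symmetric
   functions. *)

Require Import Defs.
From HB Require Import structures.
(* [finset] comes last: [classical_sets] has lemmas of the same names. *)
From mathcomp Require Import boolp fraction generic_quotient qpoly zify ring finset.
Set Implicit Arguments.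
Unset Strict Implicit.
Unset Printing Implicit Defensive.
Import Order.TTheory GRing.Theory Num.Theory.
Local Open Scope ring_scope.

(** Over the polynomial ring [P] need not be diagonalizable, so its eigenvalues enter only through
    the identity that the product of [P - j x^N] over [j <= r] is zero. On words of length [i], [P]
    is homotopic to [i x^N]; substituting, the product of the integers [i - j] times [x^(N(r+1))]
    becomes nullhomotopic. These integers are nonzero exactly because [i > r], and characteristic 0
    inverts them. Sheaf cohomology is replaced by a descent. Words of bounded length have bounded
    degree, so in a strand of large degree every coefficient lies in the ideal generated by the
    powers [x_k^(N_k(r+1))]. A cycle with such coefficients is pushed, one generator at a time and
    modulo boundaries, into the zero ideal. The bound [i < m] comes from the last stage: modulo
    [tau^m] the coefficient of [z^i], which starts at [tau^i], is visible only for [i < m]. The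
    substitution in [y] is what gives the coefficient of [z^i] this order. *)

(** * Creation and annihilation operators *)

Section Fock.
Variables (S : comNzRingType) (a b : nat).

(* Sym(F) (x) Lambda(G) for F and G free of ranks a and b over S: the value of an element at J
   is the coefficient of the product of the odd variables in J, taken in increasing order.
   Indices in 'I_(a + b) coming from lshift are even, those coming from rshift are odd. *)
Definition fock := {ffun {set 'I_b} -> {mpoly S[a]}}.

HB.instance Definition _ := GRing.Lmodule.on fock.

Definition ksign (k : 'I_b) (J : {set 'I_b}) : S :=
  (-1) ^+ #|[set l in J | (l < k)%N]|.

Lemma ksignU (k l : 'I_b) (J : {set 'I_b}) : l \notin J ->
  ksign k (l |: J) = (-1) ^+ (l < k)%N * ksign k J.
Proof.
move=> lJ; rewrite /ksign; case: ltnP => lk /=; last first.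
  rewrite mul1r; congr (_ ^+ _); apply: eq_card => x; rewrite !inE.
  by case: eqVneq => //= ->; rewrite ltnNge lk andbF.
rewrite -exprD; congr (_ ^+ _).
suff -> : [set x in l |: J | (x < k)%N] = l |: [set x in J | (x < k)%N].
  by rewrite cardsU1 !inE (negbTE lJ).
by apply/setP => x; rewrite !inE; case: eqVneq => //= ->; rewrite lk.
Qed.

Lemma ksignD (k l : 'I_b) (J : {set 'I_b}) : l \in J ->
  ksign k (J :\ l) = (-1) ^+ (l < k)%N * ksign k J.
Proof.
move=> lJ; rewrite -{2}(setD1K lJ) ksignU ?setD11 // mulrA -exprD addnn -signr_odd.
by rewrite odd_double mul1r.
Qed.

Lemma ksignU1 (k : 'I_b) (J : {set 'I_b}) : ksign k (k |: J) = ksign k J.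
Proof.
rewrite /ksign; congr (_ ^+ _); apply: eq_card => x; rewrite !inE.
by case: eqVneq => //= ->; rewrite ltnn andbF.
Qed.

Lemma ksignD1 (k : 'I_b) (J : {set 'I_b}) : ksign k (J :\ k) = ksign k J.
Proof.
rewrite /ksign; congr (_ ^+ _); apply: eq_card => x; rewrite !inE.
by case: eqVneq => //= ->; rewrite ltnn andbF.
Qed.

Lemma ksign_sqr k J : ksign k J * ksign k J = 1.
Proof. by rewrite /ksign -expr2 sqrr_sign. Qed.

Definition ann (x : 'I_(a + b)) (phi : fock) : fock :=
  match split x with
  | inl k => [ffun J => (phi J)^`M(k)]
  | inr k => [ffun J : {set 'I_b} => if k \in J then 0 else ksign k J *: phi (k |: J)]
  end.

Definition cre (x : 'I_(a + b)) (phi : fock) : fock :=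
  match split x with
  | inl k => [ffun J => 'X_k * phi J]
  | inr k => [ffun J : {set 'I_b} => if k \in J then ksign k J *: phi (J :\ k) else 0]
  end.

Fact ann_is_linear x : linear (ann x).
Proof.
move=> c p q; rewrite /ann; case: split => k; apply/ffunP => J; rewrite !ffunE.
  by rewrite linearP.
by case: ifP; rewrite ?scaler0 ?addr0 // scalerDr !scalerA mulrC.
Qed.
HB.instance Definition _ x := GRing.isLinear.Build S fock fock *:%R (ann x) (ann_is_linear x).

Fact cre_is_linear x : linear (cre x).
Proof.
move=> c p q; rewrite /cre; case: split => k; apply/ffunP => J; rewrite !ffunE.
  by rewrite mulrDr scalerAr.
by case: ifP; rewrite ?scaler0 ?addr0 // scalerDr !scalerA mulrC.
Qed.
HB.instance Definition _ x := GRing.isLinear.Build S fock fock *:%R (cre x) (cre_is_linear x).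

Definition odd_idx (x : 'I_(a + b)) : bool := if split x is inr _ then true else false.
Definition eps (x y : 'I_(a + b)) : S := (-1) ^+ (odd_idx x && odd_idx y).

Lemma ksign_swap (k l : 'I_b) (x y : S) : k != l ->
  x * ((-1) ^+ (k < l)%N * y) = - (y * ((-1) ^+ (l < k)%N * x)).
Proof.
move=> kl; have : (k < l)%N = ~~ (l < k)%N by move: kl; rewrite -val_eqE /=; lia.
by move=> ->; case: (l < k)%N => /=; ring.
Qed.

Lemma annC x y phi : ann x (ann y phi) = eps x y *: ann y (ann x phi).
Proof.
rewrite /eps /odd_idx /ann; case: (split x) => k; case: (split y) => l /=; apply/ffunP => J;
  rewrite !ffunE ?scale1r.
- by rewrite mderiv_comm.
- by case: ifP; rewrite ?linear0 // linearZ.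
- by case: ifP; rewrite ?linear0 // linearZ.
have [<-{l}|kl] := eqVneq k l.
  by case: ifP => kJ; rewrite ?scaler0 // !inE eqxx /= !scaler0.
rewrite !inE (negbTE kl) [l == k]eq_sym (negbTE kl) /=.
case: ifP => kJ; case: ifP => lJ; rewrite ?scaler0 //.
rewrite !scalerA setUCA !ksignU ?kJ ?lJ // expr1 mulN1r; congr (_ *: _).
exact: ksign_swap.
Qed.

Lemma creC x y phi : cre x (cre y phi) = eps x y *: cre y (cre x phi).
Proof.
rewrite /eps /odd_idx /cre; case: (split x) => k; case: (split y) => l /=; apply/ffunP => J;
  rewrite !ffunE ?scale1r.
- by rewrite mulrCA.
- by case: ifP; rewrite ?mulr0 // scalerAr.
- by case: ifP; rewrite ?mulr0 // scalerAr.
have [<-{l}|kl] := eqVneq k l.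
  by case: ifP => kJ; rewrite ?scaler0 // !inE eqxx /= !scaler0.
rewrite !inE (negbTE kl) [l == k]eq_sym (negbTE kl) /=.
case: ifP => kJ; case: ifP => lJ; rewrite ?scaler0 //.
rewrite !scalerA !ksignD ?kJ ?lJ // expr1 mulN1r.
have -> : J :\ k :\ l = J :\ l :\ k by apply/setP => z; rewrite !inE andbCA.
by congr (_ *: _); exact: ksign_swap.
Qed.

(** The Weyl relation for even indices and the Clifford relation for odd ones, in one formula. *)
Lemma ann_cre x y phi :
  ann x (cre y phi) = eps x y *: cre y (ann x phi) + (x == y)%:R *: phi.
Proof.
have xyE : (x == y) = (split x == split y).
  by apply/eqP/eqP => [->//|/(congr1 (@unsplit a b))]; rewrite !splitK.
rewrite xyE /eps /odd_idx /ann /cre; case: (split x) => k; case: (split y) => l /=;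
  apply/ffunP => J; rewrite !ffunE ?scale1r ?scale0r ?addr0.
- rewrite mderivM mderivX addrC mnm1E; congr (_ + _).
  have -> : (inl k == inl l :> 'I_a + 'I_b) = (k == l) by [].
  have [->|kl] := eqVneq k l.
    have -> : (U_(l) - U_(l) = 0 :> 'X_{1..a})%MM.
      by apply/mnmP => z; rewrite mnmBE subnn mnm0E.
    by rewrite scale1r mpolyX0 mul1r scale1r.
  by rewrite !scale0r mul0r.
- by case: ifP; rewrite ?linear0 // linearZ.
- by case: ifP; rewrite ?mulr0 // scalerAr.
have -> : (inr k == inr l :> 'I_a + 'I_b) = (k == l) by [].
have [<-{l}|kl] := eqVneq k l.
  rewrite scale1r; case: ifP => kJ; rewrite !inE ?eqxx /= ?kJ /= ?scaler0 ?add0r ?addr0.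
    by rewrite setD1K // ksignD1 !scalerA ksign_sqr expr1 mulr1 scaleN1r addNr.
  by rewrite setU1K ?kJ // ksignU1 scalerA ksign_sqr scale1r.
rewrite scale0r addr0 !inE (negbTE kl) [l == k]eq_sym (negbTE kl) /=.
case: ifP => kJ; case: ifP => lJ; rewrite ?scaler0 //.
rewrite !scalerA ksignU ?kJ // ksignD ?lJ // expr1 mulN1r.
have -> : (k |: J) :\ l = k |: J :\ l.
  by apply/setP => z; rewrite !inE; case: (eqVneq z l) => [->|//]; rewrite eq_sym (negbTE kl).
by congr (_ *: _); exact: ksign_swap.
Qed.

(** The derivation extending the map [u *m X] on generators. In this row convention composition of
    operators reverses products of matrices. *)
Definition bil (X : 'M[S]_(a + b)) (phi : fock) : fock :=
  \sum_k \sum_l X k l *: cre l (ann k phi).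

Fact bil_is_linear X : linear (bil X).
Proof.
move=> c p q; rewrite /bil scaler_sumr -big_split; apply: eq_bigr => k _ /=.
rewrite scaler_sumr -big_split; apply: eq_bigr => l _ /=.
by rewrite (linearP (ann k)) (linearP (cre l)) scalerDr !scalerA mulrC.
Qed.
HB.instance Definition _ X := GRing.isLinear.Build S fock fock *:%R (bil X) (bil_is_linear X).

Lemma bilD X Y phi : bil (X + Y) phi = bil X phi + bil Y phi.
Proof.
rewrite /bil -big_split; apply: eq_bigr => k _ /=; rewrite -big_split.
by apply: eq_bigr => l _ /=; rewrite mxE scalerDl.
Qed.

Lemma bilZ c X phi : bil (c *: X) phi = c *: bil X phi.
Proof.
rewrite /bil scaler_sumr; apply: eq_bigr => k _ /=; rewrite scaler_sumr.
by apply: eq_bigr => l _ /=; rewrite mxE scalerA.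
Qed.

Lemma bil0 phi : bil 0 phi = 0.
Proof. by rewrite -(scale0r 0) bilZ scale0r. Qed.

Lemma bilN X phi : bil (- X) phi = - bil X phi.
Proof. by rewrite -scaleN1r bilZ scaleN1r. Qed.

Lemma bil_sum (I : finType) (P : I -> 'M_(a + b)) phi :
  bil (\sum_i P i) phi = \sum_i bil (P i) phi.
Proof. by elim/big_rec2: _ => [|i y x _ <-]; rewrite ?bil0 // bilD. Qed.

(* The normally ordered product of [bil X] and [bil Y]. *)
Definition nord (X Y : 'M[S]_(a + b)) (phi : fock) : fock :=
  \sum_k \sum_l \sum_p \sum_q
    (X k l * Y p q * eps k q) *: cre l (cre q (ann k (ann p phi))).

(** Wick's formula with a single contraction: moving [ann k] past [cre q] leaves the term [k = q],
    where the target of [Y] meets the source of [X]. *)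
Lemma bilM X Y phi : bil X (bil Y phi) = bil (Y *m X) phi + nord X Y phi.
Proof.
have -> : bil X (bil Y phi) = \sum_k \sum_l \sum_p \sum_q
     (X k l * Y p q * (k == q)%:R) *: cre l (ann p phi) + nord X Y phi.
  rewrite /nord -big_split; apply: eq_bigr => k _ /=.
  rewrite -big_split; apply: eq_bigr => l _ /=.
  rewrite /bil -big_split !linear_sum; apply: eq_bigr => p _ /=.
  rewrite -big_split !linear_sum; apply: eq_bigr => q _ /=.
  rewrite !linearZ /= ann_cre linearD !linearZ /= addrC scalerDr !scalerA.
  by rewrite scalerDr !scalerA !mulrA.
congr (_ + _); rewrite exchange_big /= [RHS]exchange_big /=; apply: eq_bigr => l _.
rewrite exchange_big; apply: eq_bigr => p _ /=.
rewrite mxE scaler_suml; apply: eq_bigr => k _ /=.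
rewrite (bigD1 k) //= eqxx mulr1 mulrC big1 ?addr0 // => q /negbTE.
by rewrite eq_sym => ->; rewrite mulr0 scale0r.
Qed.

Definition mxparity (e : bool) (X : 'M[S]_(a + b)) : Prop :=
  forall k l, odd_idx k (+) odd_idx l != e -> X k l = 0.

(** Creations commute with each other up to sign, and so do annihilations, so no contraction
    appears. With [bilM], graded commutators of derivations reduce to those of matrices. *)
Lemma nordC e e' X Y phi : mxparity e X -> mxparity e' Y ->
  nord X Y phi = (-1) ^+ (e && e') *: nord Y X phi.
Proof.
move=> eX eY; rewrite /nord.
have -> : \sum_k \sum_l \sum_p \sum_q
    (X k l * Y p q * eps k q) *: cre l (cre q (ann k (ann p phi))) =
  \sum_p \sum_q \sum_k \sum_l
    (X k l * Y p q * eps k q) *: cre l (cre q (ann k (ann p phi))).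
  transitivity (\sum_k \sum_p \sum_l \sum_q
    (X k l * Y p q * eps k q) *: cre l (cre q (ann k (ann p phi)))).
    by apply: eq_bigr => k _; rewrite exchange_big.
  rewrite exchange_big; apply: eq_bigr => p _ /=.
  transitivity (\sum_k \sum_q \sum_l
    (X k l * Y p q * eps k q) *: cre l (cre q (ann k (ann p phi)))).
    by apply: eq_bigr => k _; rewrite exchange_big.
  by rewrite exchange_big.
rewrite scaler_sumr; apply: eq_bigr => p _; rewrite scaler_sumr; apply: eq_bigr => q _.
rewrite scaler_sumr; apply: eq_bigr => k _; rewrite scaler_sumr; apply: eq_bigr => l _.
have [ekl|/eX ->] := eqVneq (odd_idx k (+) odd_idx l) e; last first.
  by rewrite !(mul0r, mulr0, scale0r, scaler0).
have [epq|/eY ->] := eqVneq (odd_idx p (+) odd_idx q) e'; last first.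
  by rewrite !(mul0r, mulr0, scale0r, scaler0).
rewrite creC annC !linearZ /= !scalerA; congr (_ *: _).
rewrite -ekl -epq /eps.
by case: (odd_idx k); case: (odd_idx l); case: (odd_idx p); case: (odd_idx q) => /=; ring.
Qed.

(* A rank one matrix between odd indices: the normal ordered square carries the
   product of two equal odd operators. *)
Lemma nord_rank1 (X : 'M[S]_(a + b)) (u v : 'I_(a + b) -> S) phi :
  (forall x, x *+ 2 = 0 -> x = 0 :> fock) ->
  (forall k l, X k l = u k * v l) ->
  (forall k, ~~ odd_idx k -> u k = 0) -> (forall l, ~~ odd_idx l -> v l = 0) ->
  nord X X phi = 0.
Proof.
move=> tf XE u0 v0; apply: tf; apply/eqP; rewrite mulr2n addr_eq0; apply/eqP.
rewrite {1}/nord.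
have -> : \sum_k \sum_l \sum_p \sum_q
    (X k l * X p q * eps k q) *: cre l (cre q (ann k (ann p phi))) =
  \sum_k \sum_q \sum_p \sum_l
    (X k l * X p q * eps k q) *: cre l (cre q (ann k (ann p phi))).
  apply: eq_bigr => k _; rewrite exchange_big /=.
  rewrite (eq_bigr _ (fun p _ => exchange_big _ _ _ _ _ _)) /= exchange_big /=.
  by [].
rewrite /nord -sumrN; apply: eq_bigr => k _; rewrite -sumrN; apply: eq_bigr => l _.
rewrite -sumrN; apply: eq_bigr => p _; rewrite -sumrN; apply: eq_bigr => q _.
rewrite creC -scaleNr scalerA; congr (_ *: _).
rewrite !XE /eps.
have [ok|/u0 ->] := boolP (odd_idx k); last by ring.
have [ol|/v0 ->] := boolP (odd_idx l); last by ring.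
have [oq|/v0 ->] := boolP (odd_idx q); last by ring.
by rewrite /=; ring.
Qed.

End Fock.

(** * Derivations extending an endomorphism of small rank *)

Section ProdOp.
Variables (S : idomainType) (V : lmodType S).
Hypothesis scale_eq0 : forall (c : S) (x : V), c *: x = 0 -> c != 0 -> x = 0.

Definition prodop (X : V -> V) (cs : seq S) (x : V) : V :=
  foldr (fun c y => X y - c *: y) x cs.

Lemma prodop_cat X cs cs' x : prodop X (cs ++ cs') x = prodop X cs (prodop X cs' x).
Proof. exact: foldr_cat. Qed.

Lemma prodop0 (X : {linear V -> V}) cs : prodop X cs 0 = 0.
Proof. by elim: cs => //= c cs ->; rewrite linear0 scaler0 subr0. Qed.

Lemma prodopD (X : {linear V -> V}) cs x y :
  prodop X cs (x + y) = prodop X cs x + prodop X cs y.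
Proof.
by elim: cs => //= c cs ->; rewrite linearD scalerDr opprD addrACA.
Qed.

Lemma prodopZ (X : {linear V -> V}) cs d x : prodop X cs (d *: x) = d *: prodop X cs x.
Proof.
by elim: cs => //= c cs ->; rewrite linearZ /= scalerBr !scalerA [c * d]mulrC.
Qed.

Lemma prodop_scaleop (X Y : {linear V -> V}) cs d x :
  (forall y, Y y = d *: X y) ->
  prodop Y [seq d * c | c <- cs] x = d ^+ size cs *: prodop X cs x.
Proof.
move=> YE; elim: cs => [|c cs IH] /=; first by rewrite scale1r.
by rewrite IH YE linearZ /= exprS scalerBr !scalerA [d * c * _]mulrAC.
Qed.

(** On an eigenvector of the commuting summand [n], that summand is the scalar [c0]. The second
    conjunct records that the product preserves the eigenspace, which the induction needs. *)
Lemma prodop_eigen (X n Y : {linear V -> V}) cs c0 x :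
  (forall y, Y y = X y + n y) -> (forall y, n (X y) = X (n y)) -> n x = c0 *: x ->
  prodop Y cs x = prodop X [seq c - c0 | c <- cs] x /\
  n (prodop Y cs x) = c0 *: prodop Y cs x.
Proof.
move=> YE nX nx; elim: cs => [//|c cs [IH1 IH2]] /=; split.
  by rewrite YE IH2 -IH1 scalerBl opprB -addrA [c0 *: _ - _]addrC; congr (_ + _).
have nY z : n z = c0 *: z -> n (Y z) = c0 *: Y z.
  by move=> nz; rewrite YE linearD nX nz !linearZ /= scalerDr nz.
by rewrite linearB (nY _ IH2) linearZ /= IH2 scalerBr !scalerA mulrC.
Qed.

(* The eigenvalues of a sum of [r] commuting operators with n^2 = g n are among
   0, g, ..., r g. *)
Lemma prodop_sum_idem (g : S) (r : nat) (n : nat -> {linear V -> V})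
    (X : {linear V -> V}) x : g != 0 ->
  (forall y, X y = \sum_(e < r) n e y) ->
  (forall e e' y, n e (n e' y) = n e' (n e y)) ->
  (forall e y, n e (n e y) = g *: n e y) ->
  prodop X [seq j%:R * g | j <- iota 0 r.+1] x = 0.
Proof.
move=> g0 XE nC nn; elim: r X XE x => [|r IH] X XE x.
  by rewrite /= XE big_ord0 mul0r scale0r subrr.
pose Z y := \sum_(e < r) n e y.
have Zlin : linear Z.
  move=> c p q; rewrite /Z scaler_sumr -big_split; apply: eq_bigr => e _ /=.
  by rewrite linearP.
pose ZL : {linear V -> V} := HB.pack Z (GRing.isLinear.Build S V V *:%R Z Zlin).
have IHZ := IH ZL (fun=> erefl).
have XZ y : X y = ZL y + n r y by rewrite XE big_ord_recr.
have nZ y : n r (ZL y) = ZL (n r y).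
  by rewrite /= /Z linear_sum; apply: eq_bigr => e _; exact: nC.
(* After multiplication by [g], [x] splits into a vector on which [n r] acts as [g] and one that it
   kills; no division by [g] is required. *)
apply: (@scale_eq0 g) => //; rewrite -prodopZ.
have -> : g *: x = n r x + (g *: x - n r x) by rewrite addrC subrK.
have n1 : n r (n r x) = g *: n r x by [].
have n0 : n r (g *: x - n r x) = 0 *: (g *: x - n r x).
  by rewrite linearB linearZ /= nn subrr scale0r.
rewrite prodopD (prodop_eigen _ XZ nZ n1).1 (prodop_eigen _ XZ nZ n0).1.
(* Shifted by the eigenvalue [g], the list of scalars ends with the list of the induction
   hypothesis; for the eigenvalue 0 it begins with that list. *)
have -> : [seq c - g | c <- [seq j%:R * g | j <- iota 0 r.+2]] =
          [:: - g] ++ [seq j%:R * g | j <- iota 0 r.+1].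
  have -> : iota 0 r.+2 = 0%N :: map (addn 1) (iota 0 r.+1) by rewrite -iotaDl.
  rewrite 2!map_cons mul0r sub0r; congr (_ :: _).
  rewrite -!map_comp; apply: eq_map => j /=.
  by rewrite natrD mulrDl mul1r addrC addKr.
rewrite prodop_cat IHZ prodop0 add0r.
rewrite -[r.+2]addn1 iotaD !map_cat.
have -> : [seq c - 0 | c <- [seq j%:R * g | j <- iota 0 r.+1]] = [seq j%:R * g | j <- iota 0 r.+1].
  by rewrite -map_comp; apply: eq_map => j /=; rewrite subr0.
by rewrite prodop_cat IHZ.
Qed.
End ProdOp.

Local Notation "x %:F" := (tofrac x).

Section Denominators.
Variable S : idomainType.

Lemma frac_denom (x : {fraction S}) : exists (n d : S), d != 0 /\ d%:F * x = n%:F.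
Proof.
elim/quotW: x => x; exists \n_x, \d_x; split; first exact: denom_ratioP.
have -> : (\d_x)%:F = \pi_({fraction S})%qT (Ratio \d_x 1) by rewrite piE.
have -> : (\n_x)%:F = \pi_({fraction S})%qT (Ratio \n_x 1) by rewrite piE.
rewrite -[_ * _]/(FracField.mul _ _) !piE; apply/eqmodP; rewrite /= FracField.equivfE.
by rewrite !numden_Ratio ?(oner_eq0, mulf_neq0, denom_ratioP) // !mul1r !mulr1 mulrC.
Qed.

Lemma frac_mx_denom p q (A : 'M[{fraction S}]_(p, q)) :
  exists (d : S) (B : 'M[S]_(p, q)), d != 0 /\ map_mx (@tofrac S) B = d%:F *: A.
Proof.
have /choice [nd ndP] : forall ij : 'I_p * 'I_q,
    exists nd : S * S, nd.2 != 0 /\ nd.2%:F * A ij.1 ij.2 = nd.1%:F.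
  by move=> ij; have [n [d ?]] := frac_denom (A ij.1 ij.2); exists (n, d).
exists (\prod_ij (nd ij).2).
exists (\matrix_(i, j) ((\prod_(ij | ij != (i, j)) (nd ij).2) * (nd (i, j)).1)); split.
  by apply/prodf_neq0 => ij _; case: (ndP ij).
apply/matrixP => i j; rewrite !mxE [in RHS](bigD1 (i, j)) //= !tofracM -(ndP (i, j)).2 /=.
by rewrite /= mulrCA mulrA.
Qed.
End Denominators.

Section RankAnnihilator.
Variables (S : idomainType) (a b : nat).
Hypothesis char0 : forall n, n.+1%:R != 0 :> S.
Local Notation A := (fock S a b).

Lemma fock_scale_eq0 (c : S) (x : A) : c *: x = 0 -> c != 0 -> x = 0.
Proof.
move=> /ffunP cx c0; apply/ffunP => J; move: (cx J); rewrite !ffunE.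
by move/eqP; rewrite mscalerI (negbTE c0) => /eqP.
Qed.

Lemma odd_idx_lshift k : odd_idx (lshift b k : 'I_(a + b)) = false.
Proof. by rewrite /odd_idx (unsplitK (inl k)). Qed.

Lemma odd_idx_rshift k : odd_idx (rshift a k : 'I_(a + b)) = true.
Proof. by rewrite /odd_idx (unsplitK (inr k)). Qed.

Lemma mxparity_odd (X : 'M[S]_(a, b)) Y : mxparity true (block_mx 0 X Y 0).
Proof.
move=> k l; case: (split_ordP k) => i ->; case: (split_ordP l) => j ->;
  by rewrite ?odd_idx_lshift ?odd_idx_rshift // ?block_mxEul ?block_mxEdr ?mxE.
Qed.

Lemma mxparity_even (X : 'M[S]_a) (Y : 'M[S]_b) : mxparity false (block_mx X 0 0 Y).
Proof.
move=> k l; case: (split_ordP k) => i ->; case: (split_ordP l) => j ->;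
  by rewrite ?odd_idx_lshift ?odd_idx_rshift // ?block_mxEur ?block_mxEdl ?mxE.
Qed.

Definition oddblock (P : 'M[S]_b) : 'M[S]_(a + b) := block_mx 0 0 0 P.

(* After clearing denominators, [P = U V] with [V U] scalar, so the derivation extending [P]
   is a sum of commuting operators to which [prodop_sum_idem] applies. *)
Lemma prodop_bil_rank (P : 'M[S]_b) (f : S) r (phi : A) :
  f != 0 -> P *m P = f *: P -> (\rank (map_mx (@tofrac S) P) <= r)%N ->
  prodop (bil (oddblock P)) [seq j%:R * f | j <- iota 0 r.+1] phi = 0.
Proof.
move=> f0 PP; set PF := map_mx _ P; set rho := \rank PF => rhor.
suff H phi' : prodop (bil (oddblock P)) [seq j%:R * f | j <- iota 0 rho.+1] phi' = 0.
  by rewrite -(subnKC rhor) -addSn iotaD map_cat prodop_cat H.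
(* With [PF = C R], the relation [C R C R = f C R] loses its outer factors, since [C] and [R] have
   full rank. *)
have RC : row_base PF *m col_base PF = f%:F%:M.
  apply: (row_full_inj (col_base_full PF)); apply: (row_free_inj (row_base_free PF)).
  rewrite mulmxA mulmx_base -mulmxA mulmx_base -/PF.
  rewrite -map_mxM PP mul_mx_scalar -scalemxAl mulmx_base.
  by rewrite map_mxZ.
have [d1 [U [d10 UE]]] := frac_mx_denom (col_base PF).
have [d2 [V [d20 VE]]] := frac_mx_denom (row_base PF).
have inj p q : injective (map_mx (@tofrac S) : 'M_(p, q) -> _).
  move=> X Y /matrixP XY; apply/matrixP => i j; have := XY i j.
  by rewrite !mxE => /eqP; rewrite tofrac_eq => /eqP.
pose d := d1 * d2; have d0 : d != 0 by rewrite mulf_neq0.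
have UV : U *m V = d *: P.
  apply: inj; rewrite map_mxM UE VE -scalemxAl -scalemxAr scalerA mulmx_base -tofracM -/d.
  by rewrite map_mxZ.
have VU : V *m U = (d * f)%:M.
  apply: inj; rewrite map_mxM UE VE -scalemxAl -scalemxAr scalerA RC -tofracM map_scalar_mx.
  by rewrite scale_scalar_mx -tofracM [d2 * d1]mulrC.
(* The rank one summands of [U V]. The value 0 out of range lets [e] run over all natural numbers,
   as [prodop_sum_idem] expects. *)
pose X (e : nat) : 'M[S]_(a + b) := 
  if insub e is Some e then oddblock (col e U *m row e V) else 0.
have ob0 : oddblock 0 = 0 by rewrite /oddblock block_mx_const.
have obM Y Z : oddblock Y *m oddblock Z = oddblock (Y *m Z).
  by rewrite /oddblock mulmx_block !mulmx0 !mul0mx !addr0 add0r.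
have obE e : exists Y, X e = oddblock Y.
  by rewrite /X; case: insubP => [e' _ _|_]; [eexists | exists 0; rewrite ob0].
have ev e : mxparity false (X e) by have [Y ->] := obE e; exact: mxparity_even.
have X_mul e e' : X e *m X e' = if e == e' then (d * f) *: X e else 0.
  rewrite /X; case: insubP => [i _ <-|_]; last by rewrite mul0mx scaler0; case: ifP.
  case: insubP => [j _ <-|je]; last first.
    by rewrite mulmx0; case: eqP => // ie; rewrite -ie ltn_ord in je.
  rewrite obM mulmxA -(mulmxA (col i U)).
  have -> : row i V *m col j U = ((V *m U) i j)%:M.
    by apply/matrixP => x y; rewrite !ord1 !mxE mulr1n; apply: eq_bigr => z _; rewrite !mxE.
  rewrite VU mxE (inj_eq val_inj); case: eqVneq => [<-|_] /=.
    rewrite mulr1n mul_mx_scalar -scalemxAl /oddblock.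
    by rewrite scale_block_mx !scaler0.
  by rewrite mulr0n raddf0 mulmx0 mul0mx ob0.
have tf2 (x : A) : x *+ 2 = 0 -> x = 0.
  by rewrite -scaler_nat => /fock_scale_eq0; apply; apply: char0.
(* Here it matters that [P] acts on odd variables: the square of an odd operator vanishes, so a rank
   one piece has only the eigenvalues 0 and [d f]. On even variables they would be unbounded. *)
have nn e y : bil (X e) (bil (X e) y) = (d * f) *: bil (X e) y.
  rewrite bilM X_mul eqxx bilZ [nord _ _ _](_ : _ = 0) ?addr0 //.
  rewrite /X; case: insubP => [i _ _|_]; last first.
    by apply: (@nord_rank1 _ _ _ _ (fun=> 0) (fun=> 0)) => // *; rewrite mxE mul0r.
  pose u (k : 'I_(a + b)) := if split k is inr k then U k i else 0.
  pose v (k : 'I_(a + b)) := if split k is inr k then V i k else 0.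
  apply: (@nord_rank1 _ _ _ _ u v) => //.
  - move=> k l; case: (split_ordP k) => k' ->; case: (split_ordP l) => l' ->;
    rewrite /u /v ?(unsplitK (inl _)) ?(unsplitK (inr _)) ?mul0r ?mulr0
      ?block_mxEul ?block_mxEur ?block_mxEdl ?block_mxEdr mxE //.
    by rewrite big_ord1 !mxE.
  - by move=> k; rewrite /u /odd_idx; case: split.
  - by move=> k; rewrite /v /odd_idx; case: split.
have nC e e' y : bil (X e) (bil (X e') y) = bil (X e') (bil (X e) y).
  have [->//|ee'] := eqVneq e e'.
  rewrite !bilM !X_mul [e' == e]eq_sym (negbTE ee') !bil0 !add0r.
  by rewrite (nordC _ (ev e) (ev e')) expr0 scale1r.
have bilS y : bil (d *: oddblock P) y = \sum_(e < rho) bil (X e) y.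
  rewrite -(bil_sum (fun e : 'I_rho => X e)); congr (bil _ y).
  rewrite /oddblock scale_block_mx !scaler0 -UV.
  have -> : U *m V = \sum_(e < rho) col e U *m row e V.
    apply/matrixP => i j; rewrite summxE mxE; apply: eq_bigr => e _.
    by rewrite mxE big_ord1 !mxE.
  rewrite /X; elim/big_rec2: _ => [|e Y Z _ <-]; first by rewrite -[RHS]ob0.
  case: insubP => [e' _ ee'|]; last by rewrite ltn_ord.
  have -> : e' = e by apply: val_inj.
  by rewrite /oddblock add_block_mx !addr0.
have := prodop_sum_idem fock_scale_eq0 (n := fun e => bil (X e) : {linear A -> A})
   (X := bil (d *: oddblock P) : {linear A -> A}) phi' (mulf_neq0 d0 f0) bilS nC nn.
rewrite (_ : [seq _ | _ <- _] = [seq d * c | c <- [seq j%:R * f | j <- iota 0 rho.+1]]); last first.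
  by rewrite -map_comp; apply: eq_map => j /=; rewrite mulrCA.
rewrite (@prodop_scaleop _ _ (bil (oddblock P)) (bil (d *: oddblock P))); last first.
  by move=> y; rewrite /= bilZ.
by move/fock_scale_eq0; apply; rewrite expf_neq0.
Qed.
End RankAnnihilator.

(** * Exactness in positions of length greater than the rank *)

Section Coefficients.
Variables (S : comNzRingType) (a b : nat).
Local Notation A := (fock S a b).

Definition ideal_like (Q : S -> Prop) : Prop :=
  [/\ Q 0, forall x y, Q x -> Q y -> Q (x + y) & forall c x, Q x -> Q (c * x)].

Definition coefs_in (Q : S -> Prop) (phi : A) : Prop := forall J mu, Q (phi J)@_mu.

Definition of_length (i : nat) (phi : A) : Prop :=
  forall (J : {set 'I_b}) mu, (#|J| + mdeg mu)%N != i -> (phi J)@_mu = 0.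

Lemma mcoeffXM (p : {mpoly S[a]}) k mu :
  ('X_k * p)@_mu = if (U_(k) <= mu)%MM then p@_(mu - U_(k))%MM else 0.
Proof.
rewrite -[LHS]/(('X_k * p)@_mu) -commr_mpolyX; case: ifP => [le|nle].
  by rewrite -{1}(submK le) addmC mcoeffMX.
apply: memN_msupp_eq0; rewrite (perm_mem (msuppMX _ _)); apply/mapP => -[nu _ E].
by move: nle; rewrite E lem_addr.
Qed.

Section IdealLike.
Variables (Q : S -> Prop) (idealQ : ideal_like Q).

Lemma coefs_in0 : coefs_in Q 0.
Proof. by case: idealQ => Q0 _ _ J mu; rewrite ffunE mcoeff0. Qed.

Lemma coefs_inD phi psi : coefs_in Q phi -> coefs_in Q psi -> coefs_in Q (phi + psi).
Proof. by case: idealQ => _ QD _ H H' J mu; rewrite ffunE mcoeffD; apply: QD. Qed.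

Lemma coefs_inZ c phi : coefs_in Q phi -> coefs_in Q (c *: phi).
Proof. by case: idealQ => _ _ QM H J mu; rewrite ffunE mcoeffZ; apply: QM. Qed.

Lemma coefs_inN phi : coefs_in Q phi -> coefs_in Q (- phi).
Proof. by rewrite -scaleN1r; apply: coefs_inZ. Qed.

Lemma coefs_in_ann x phi : coefs_in Q phi -> coefs_in Q (ann x phi).
Proof.
case: idealQ => Q0 _ QM H J mu; rewrite /ann; case: split => k; rewrite ffunE.
  by rewrite mcoeff_mderiv -mulr_natl; apply: QM.
by case: ifP => _; rewrite ?mcoeff0 // mcoeffZ; apply: QM.
Qed.

Lemma coefs_in_cre x phi : coefs_in Q phi -> coefs_in Q (cre x phi).
Proof.
case: idealQ => Q0 _ QM H J mu; rewrite /cre; case: split => k; rewrite ffunE.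
  by rewrite mcoeffXM; case: ifP.
by case: ifP => _; rewrite ?mcoeff0 // mcoeffZ; apply: QM.
Qed.

Lemma coefs_in_bil X phi : coefs_in Q phi -> coefs_in Q (bil X phi).
Proof.
move=> H; rewrite /bil; elim/big_rec: _ => [|k u _]; first exact: coefs_in0.
apply: coefs_inD; elim/big_rec: _ => [|l w _]; first exact: coefs_in0.
by apply: coefs_inD; apply/coefs_inZ/coefs_in_cre/coefs_in_ann.
Qed.
End IdealLike.

Lemma of_length0 i : of_length i 0.
Proof. by move=> J mu _; rewrite ffunE mcoeff0. Qed.

Lemma of_lengthD i phi psi : of_length i phi -> of_length i psi -> of_length i (phi + psi).
Proof. by move=> H H' J mu n; rewrite ffunE mcoeffD H // H' // addr0. Qed.

Lemma of_lengthZ i c phi : of_length i phi -> of_length i (c *: phi).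
Proof. by move=> H J mu n; rewrite ffunE mcoeffZ H // mulr0. Qed.

Lemma of_lengthN i phi : of_length i phi -> of_length i (- phi).
Proof. by rewrite -scaleN1r; apply: of_lengthZ. Qed.

Lemma of_length_bil i X phi : of_length i phi -> of_length i (bil X phi).
Proof.
move=> H; rewrite /bil; elim/big_rec: _ => [|k u _]; first exact: of_length0.
apply: of_lengthD; elim/big_rec: _ => [|l w _]; first exact: of_length0.
apply: of_lengthD; apply: of_lengthZ.
have Hann (J : {set 'I_b}) mu : (#|J| + mdeg mu)%N.+1 != i -> (ann k phi J)@_mu = 0.
  rewrite /ann => ni; case: split => k'; rewrite ffunE.
    by rewrite mcoeff_mderiv H ?mul0rn // mdegD mdeg1 addn1 addnS.
  by case: ifP => [_|kJ]; rewrite ?mcoeff0 // mcoeffZ H ?mulr0 // cardsU1 kJ.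
move=> J mu ni; rewrite /cre; case: split => k'; rewrite ffunE.
  rewrite mcoeffXM; case: ifP => // /submK E; apply: Hann.
  by rewrite -addnS -[(mdeg _).+1]addn1 -(mdeg1 k') -mdegD E.
case: ifP => [kJ|_]; rewrite ?mcoeff0 // mcoeffZ Hann ?mulr0 //.
by rewrite -addSn; move: ni; rewrite (cardsD1 k') kJ.
Qed.

(** Euler's formula: an even index contributes its exponent, an odd one its membership in [J]. *)
Lemma of_length_bil1 i phi : of_length i phi -> bil 1%:M phi = i%:R *: phi.
Proof.
move=> H; apply/ffunP => J; apply/mpolyP => mu.
have -> : bil 1%:M phi = \sum_k cre k (ann k phi).
  apply: eq_bigr => k _; rewrite (bigD1 k) //= mxE eqxx scale1r big1 ?addr0 // => l.
  by rewrite mxE eq_sym => /negbTE ->; rewrite scale0r.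
rewrite big_split_ord !ffunE !sum_ffunE mcoeffD !raddf_sum mcoeffZ /=.
have -> : \sum_(k < a) (cre (lshift b k) (ann (lshift b k) phi) J)@_mu = (phi J)@_mu *+ mdeg mu.
  rewrite mdegE -sumrMnr; apply: eq_bigr => k _.
  rewrite /cre /ann (unsplitK (inl k)) !ffunE mcoeffXM.
  case: ifP => [le|]; last by rewrite lep1mP => /negbFE/eqP ->.
  rewrite mcoeff_mderiv submK // mnmBE mnm1E eqxx subn1 prednK //.
  by rewrite lt0n -lep1mP.
have -> : \sum_(k < b) (cre (rshift a k) (ann (rshift a k) phi) J)@_mu = (phi J)@_mu *+ #|J|.
  rewrite -sum1_card -sumrMnr [RHS]big_mkcond /=; apply: eq_bigr => k _.
  rewrite /cre /ann (unsplitK (inr k)) !ffunE; case: ifP => kJ; last by rewrite mcoeff0.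
  by rewrite !inE eqxx /= setD1K // ksignD1 scalerA ksign_sqr scale1r.
rewrite -mulrnDr addnC.
have [<-|ni] := eqVneq (#|J| + mdeg mu)%N i; first by rewrite mulr_natl.
by rewrite H // mul0rn mulr0.
Qed.

End Coefficients.

Section Descent.
Variables (S : idomainType) (a b : nat).
Hypothesis natU : forall n, n.+1%:R \is a @GRing.unit S.
Local Notation A := (fock S a b).

Definition mapcoef (F : S -> S) (p : {mpoly S[a]}) : {mpoly S[a]} :=
  \sum_(mu <- msupp p) F p@_mu *: 'X_[mu].

Lemma mapcoefE F p mu : F 0 = 0 -> (mapcoef F p)@_mu = F p@_mu.
Proof.
move=> F0; rewrite /mapcoef raddf_sum /=.
have [mup|nmu] := boolP (mu \in msupp p).
  rewrite (bigD1_seq mu) ?msupp_uniq //= mcoeffZ mcoeffX eqxx mulr1 big1 ?addr0 // => nu.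
  by rewrite mcoeffZ mcoeffX => /negbTE ->; rewrite mulr0.
rewrite (memN_msupp_eq0 nmu) F0 big_seq big1 // => nu nup.
by rewrite mcoeffZ mcoeffX; case: eqVneq nmu => [<-|_]; rewrite ?nup // mulr0.
Qed.

(* Modulo [Q] and boundaries, [bil P] multiplies [y] by [i f]. *)
Lemma homotopy_step (d h P : 'M[S]_(a + b)) (f : S) r i (Q : S -> Prop) (y : A) :
  ideal_like Q -> mxparity true d -> mxparity true h -> mxparity false P ->
  d *m h + h *m d = f%:M - P -> d *m P = 0 -> P *m d = 0 ->
  (forall phi : A, prodop (bil P) [seq j%:R * f | j <- iota 0 r.+1] phi = 0) ->
  (r < i)%N -> of_length i y -> coefs_in Q (bil d y) ->
  exists beta, of_length i beta /\ coefs_in Q (f ^+ r.+1 *: y - bil d beta).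
Proof.
move=> idQ od oh eP dh dP Pd annP ri ly Qdy.
(* The graded commutator of the odd derivations of [d] and [h] is the derivation of [f - P], and
   that of [f] multiplies by [i f]. *)
have Py : bil P y = (i%:R * f) *: y - (bil d (bil h y) + bil h (bil d y)).
  have -> : bil d (bil h y) + bil h (bil d y) = bil (f%:M - P) y.
    rewrite !bilM (nordC _ od oh) /= expr1 scaleN1r addrACA addNr addr0 -bilD addrC.
    by rewrite -dh.
  rewrite bilD bilN opprD opprK addrA.
  suff -> : bil f%:M y = (i%:R * f) *: y by rewrite subrr add0r.
  by rewrite -scalemx1 bilZ (of_length_bil1 ly) scalerA mulrC.
have PdC phi : bil P (bil d phi) = bil d (bil P phi).
  by rewrite (bilM P d) (bilM d P) dP Pd !bil0 !add0r (nordC _ eP od) expr0 scale1r.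
(* Each factor [P - c] becomes the scalar [i f - c]. The error consists of a boundary, with
   primitive corrected by [- C h y], and of a multiple of [h (d y)], which lies in [Q] because [d y]
   does. *)
have main cs : exists beta, of_length i beta /\ coefs_in Q
    (prodop (bil P) cs y - (\prod_(c <- cs) (i%:R * f - c)) *: y - bil d beta).
  elim: cs => [|c cs [beta [lb Qb]]].
    exists 0; split; first exact: of_length0.
    by rewrite big_nil scale1r /= subrr linear0 subrr; apply: coefs_in0.
  set C := \prod_(c <- cs) _ in Qb; rewrite big_cons -/C /=.
  set psi := prodop _ _ _ in Qb *; set eta := _ - _ - _ in Qb.
  have psiE : psi = C *: y + bil d beta + eta.
    by rewrite addrC /eta -(addrA psi) -opprD subrK.
  exists (bil P beta - c *: beta - C *: bil h y); split.
    apply: of_lengthD; last by apply/of_lengthN/of_lengthZ/of_length_bil.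
    apply: of_lengthD; last exact/of_lengthN/of_lengthZ.
    exact: of_length_bil.
  pose Z phi := bil P phi - c *: phi.
  have ZD u v : Z (u + v) = Z u + Z v by rewrite /Z linearD scalerDr opprD addrACA.
  have ZZ u v : Z (u *: v) = u *: Z v.
    by rewrite /Z linearZ scalerBr !scalerA [c * u]mulrC.
  have Zd u : Z (bil d u) = bil d (Z u) by rewrite /Z PdC (linearB (bil d)) (linearZ_LR (bil d)).
  have Zy : Z y = (i%:R * f - c) *: y - (bil d (bil h y) + bil h (bil d y)).
    by rewrite /Z Py scalerBl addrAC.
  suff -> : bil P psi - c *: psi - ((i%:R * f - c) * C) *: y -
      bil d (bil P beta - c *: beta - C *: bil h y) = Z eta - C *: bil h (bil d y).
    apply: (coefs_inD idQ); last exact/(coefs_inN idQ)/(coefs_inZ idQ)/(coefs_in_bil idQ).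
    apply: (coefs_inD idQ); first exact/(coefs_in_bil idQ).
    exact/(coefs_inN idQ)/(coefs_inZ idQ).
  rewrite -[bil P psi - _]/(Z psi) -[bil P beta - c *: beta]/(Z beta).
  clearbody eta Z; rewrite psiE !ZD ZZ Zd Zy.
  rewrite (linearB (bil d)) (linearZ_LR (bil d)) /= scalerBr scalerDr scalerA [C * _]mulrC.
  rewrite !opprD opprK !addrA.
  by rewrite (+%R.[ACl 1*6*(2*8)*(4*7)*5*3]) /= subrr addNr subrr !add0r.
have [beta [lb]] := main [seq j%:R * f | j <- iota 0 r.+1].
rewrite annP sub0r big_map.
have -> : \prod_(j <- iota 0 r.+1) (i%:R * f - j%:R * f) =
    (\prod_(j <- iota 0 r.+1) (i - j)%:R) * f ^+ r.+1.
  rewrite -[in f ^+ _](size_iota 0 r.+1).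
  have : all (fun j => j <= i)%N (iota 0 r.+1).
    by apply/allP => j; rewrite mem_iota add0n ltnS => /andP[_ jr]; exact: leq_trans (ltnW ri).
  elim: (iota 0 r.+1) => [|j s IH] /=; first by rewrite !big_nil expr0 mul1r.
  case/andP => ji /IH; rewrite !big_cons => ->; rewrite -mulrBl -natrB //.
  by rewrite exprS mulrACA.
(* The product of [i - j] for [j <= r]: a product of positive integers since [r < i], hence a
   unit. *)
set kappa := \prod_(j <- _) _ => Qb.
have kappaU : kappa \is a GRing.unit.
  rewrite /kappa big_seq; apply: rpred_prod => j; rewrite mem_iota add0n ltnS => /andP[_ jr].
  by rewrite -(subnSK (leq_ltn_trans jr ri)) natU.
exists (- kappa^-1 *: beta); split; first exact: of_lengthZ.
suff -> : f ^+ r.+1 *: y - bil d (- kappa^-1 *: beta) =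
    - kappa^-1 *: (- ((kappa * f ^+ r.+1) *: y) - bil d beta).
  exact: (coefs_inZ idQ).
rewrite linearZ /= scalerBr; congr (_ - _).
by rewrite scaleNr scalerN opprK scalerA mulKr.
Qed.

(** Dividing coefficients gives [z = f^(r+1) y + w] with [w] in [Q]. From [d z = 0],
    [f^(r+1) d y = - d w] lies in [Q]; regularity puts [d y] in [Q], and [homotopy_step] makes
    [f^(r+1) y] a boundary modulo [Q]. *)
Lemma descent_step (d h P : 'M[S]_(a + b)) (f : S) r i (Q Q' : S -> Prop)
    (quo rem : S -> S) (z : A) :
  ideal_like Q -> quo 0 = 0 -> rem 0 = 0 ->
  (forall p, p = f ^+ r.+1 * quo p + rem p) -> (forall p, Q' p -> Q (rem p)) ->
  (forall p, Q (f ^+ r.+1 * p) -> Q p) ->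
  (forall phi : A, bil d (bil d phi) = 0) ->
  mxparity true d -> mxparity true h -> mxparity false P ->
  d *m h + h *m d = f%:M - P -> d *m P = 0 -> P *m d = 0 ->
  (forall phi : A, prodop (bil P) [seq j%:R * f | j <- iota 0 r.+1] phi = 0) ->
  (r < i)%N -> of_length i z -> bil d z = 0 -> coefs_in Q' z ->
  exists beta, of_length i beta /\ coefs_in Q (z - bil d beta).
Proof.
move=> idQ quo0 rem0 qrE Qrem reg dd od oh eP dh dP Pd annP ri lz dz Qz.
pose y : A := [ffun J => mapcoef quo (z J)].
pose w : A := [ffun J => mapcoef rem (z J)].
have zE : z = f ^+ r.+1 *: y + w.
  apply/ffunP => J; apply/mpolyP => mu; rewrite !ffunE mcoeffD mcoeffZ !mapcoefE //.
have Qw : coefs_in Q w by move=> J mu; rewrite ffunE mapcoefE //; apply: Qrem.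
have ly : of_length i y by move=> J mu ni; rewrite ffunE mapcoefE // lz.
have Qdy : coefs_in Q (bil d y).
  move=> J mu; apply: reg; rewrite -mcoeffZ.
  have -> : f ^+ r.+1 *: bil d y J = (- bil d w) J.
    move: dz; rewrite zE linearD linearZ /= => /eqP; rewrite addr_eq0 => /eqP <-.
    by rewrite ffunE.
  exact/(coefs_inN idQ)/(coefs_in_bil idQ).
have [beta [lb Qb]] := homotopy_step idQ od oh eP dh dP Pd annP ri ly Qdy.
by exists beta; split=> //; rewrite zE addrAC; apply: (coefs_inD idQ).
Qed.

(** Subtracting a boundary leaves a cycle of the same length, so [descent_step] can be iterated from
    [Q m] down to [Q 0]. *)
Lemma descent (d : 'M[S]_(a + b)) r i m (f : nat -> S) (Q : nat -> S -> Prop)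
    (quo rem : nat -> S -> S) (z : A) :
  (forall k, ideal_like (Q k)) -> (forall k, quo k 0 = 0) -> (forall k, rem k 0 = 0) ->
  (forall k p, (k < m)%N -> p = f k ^+ r.+1 * quo k p + rem k p) ->
  (forall k p, (k < m)%N -> Q k.+1 p -> Q k (rem k p)) ->
  (forall k p, (k < m)%N -> Q k (f k ^+ r.+1 * p) -> Q k p) ->
  (forall p, Q 0 p -> p = 0) ->
  (forall phi : A, bil d (bil d phi) = 0) -> mxparity true d ->
  (forall k, (k < m)%N -> exists h P : 'M[S]_(a + b),
    [/\ mxparity true h, mxparity false P, d *m h + h *m d = (f k)%:M - P,
        d *m P = 0 /\ P *m d = 0 &
        forall phi : A, prodop (bil P) [seq j%:R * f k | j <- iota 0 r.+1] phi = 0]) ->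
  (r < i)%N -> of_length i z -> bil d z = 0 -> coefs_in (Q m) z ->
  exists beta, z = bil d beta.
Proof.
move=> idQ quo0 rem0 qrE Qrem reg Q0 dd od hP ri lz dz Qz.
suff H k : (k <= m)%N -> exists beta, of_length i beta /\
    coefs_in (Q (m - k)%N) (z - bil d beta).
  have [beta [_]] := H m (leqnn m); rewrite subnn => Qb; exists beta.
  apply/eqP; rewrite -subr_eq0; apply/eqP/ffunP => J; apply/mpolyP => mu.
  by rewrite [in RHS]ffunE mcoeff0; apply: Q0.
elim: k => [|k IH] km.
  by exists 0; split; [exact: of_length0 | rewrite linear0 subr0 subn0].
have [beta [lb Qb]] := IH (ltnW km).
have km' : (m - k.+1 < m)%N by rewrite ltn_subrL /= (leq_ltn_trans _ km).
have [h [P [oh eP dh [dP Pd] annP]]] := hP _ km'.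
have lz' : of_length i (z - bil d beta) by apply: of_lengthD => //; exact/of_lengthN/of_length_bil.
have dz' : bil d (z - bil d beta) = 0.
  by rewrite linearB /= dz dd subrr.
have [|beta' [lb' Qb']] := descent_step (idQ _) (quo0 _) (rem0 _) (fun p => qrE _ p km')
    (fun p => Qrem _ p km') (fun p => reg _ p km') dd od oh eP dh dP Pd annP ri lz' dz'.
  by rewrite subnSK.
exists (beta + beta'); split; first exact: of_lengthD.
by rewrite linearD opprD addrA.
Qed.
End Descent.

(** * Powers of the variables as a regular sequence, tested on monomials *)

Section MonomialIdeal.
Variables (K : fieldType) (m : nat).
Local Notation S := {mpoly K[m]}.

(** The ideal generated by the ['X_j ^+ M j] with [j < k]: membership in a monomial ideal can be
    read off the support. *)
Definition gen_ideal (M : 'I_m -> nat) (k : nat) (p : S) : Prop :=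
  forall mu, p@_mu != 0 -> exists j : 'I_m, (j < k)%N && (M j <= mu j)%N.

Lemma gen_ideal_like M k : ideal_like (gen_ideal M k).
Proof.
split=> [mu|p q Hp Hq mu|c p Hp mu]; first by rewrite mcoeff0 eqxx.
  rewrite mcoeffD; have [p0|/Hp//] := eqVneq p@_mu 0; rewrite p0 add0r; exact: Hq.
rewrite -mcoeff_msupp => /msuppM_le /allpairsP [[m1 m2] /= [_]].
rewrite mcoeff_msupp => /Hp [j /andP[jk Mj]] ->; exists j; rewrite jk mnmDE.
exact: leq_trans (leq_addl _ _).
Qed.

(** Multiplication by a power of ['X_k] moves only the exponent at [k], while the generators with
    [j < k] test the other exponents. *)
Lemma gen_ideal_reg M (k : 'I_m) (p : S) :
  gen_ideal M k ('X_k ^+ M k * p) -> gen_ideal M k p.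
Proof.
move=> H mu; have -> : p@_mu = ('X_k ^+ M k * p)@_(U_(k) *+ M k + mu)%MM.
  by rewrite mpolyXn -commr_mpolyX mcoeffMX.
move/H => [j /andP[jk]]; rewrite mnmDE mulmnE mnm1E => Mj; exists j; rewrite jk.
by move: Mj; rewrite -val_eqE /= gtn_eqF.
Qed.

Definition mquo (k : 'I_m) N (p : S) : S :=
  \sum_(mu <- msupp p | (N <= mu k)%N) p@_mu *: 'X_[mu - U_(k) *+ N].
Definition mrem (k : 'I_m) N (p : S) : S :=
  \sum_(mu <- msupp p | ~~ (N <= mu k)%N) p@_mu *: 'X_[mu].

Lemma mquo_rem k N p : p = 'X_k ^+ N * mquo k N p + mrem k N p.
Proof.
rewrite {1}[p]mpolyE (bigID (fun mu : 'X_{1..m} => N <= mu k)%N) /=; congr (_ + _).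
rewrite mulr_sumr; apply: eq_bigr => mu le; rewrite -scalerAr mpolyXn -mpolyXD.
congr (_ *: 'X_[_]); rewrite addmC submK //; apply/mnm_lepP => j.
by rewrite mulmnE mnm1E; case: eqVneq => [<-|]; rewrite ?mul1n ?mul0n.
Qed.

(** A monomial kept by [mrem] is not divisible by ['X_k ^+ M k], so a generator dividing it has a
    smaller index. *)
Lemma gen_ideal_mrem M (k : 'I_m) p :
  gen_ideal M k.+1 p -> gen_ideal M k (mrem k (M k) p).
Proof.
move=> H mu; rewrite /mrem raddf_sum /= => nz.
have /hasP[nu nup /andP[nuk]] :
    has (fun nu : 'X_{1..m} => ~~ (M k <= nu k)%N && (nu == mu)) (msupp p).
  apply: contraNT nz; rewrite -all_predC => /allP nz; apply/eqP.
  rewrite big_seq_cond big1 // => nu /andP[nup nuk].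
  by rewrite mcoeffZ mcoeffX; move: (nz _ nup); rewrite /= nuk /= => /negbTE ->; rewrite mulr0.
move/eqP => E; move: nup nuk; rewrite E mcoeff_msupp => /H [j /andP[jk Mj]] nuk; exists j.
rewrite Mj andbT ltn_neqAle -ltnS jk andbT; apply: contra nuk => /eqP /val_inj <-; exact: Mj.
Qed.

End MonomialIdeal.

(** * Even and odd monomials in a strand *)

Section Supertrace.
Variable K : fieldType.

(* [k = (1 - M M^+) M^+] is a contracting homotopy for [M], so the trace of [G] is that of
   [G M k + G k M], which vanishes since [G] anticommutes with [M]. *)
Lemma mxtrace_exact n (M G : 'M[K]_n) :
  M *m M = 0 -> (forall u : 'rV_n, u *m M = 0 -> exists v, u = v *m M) ->
  G *m M = - (M *m G) -> \tr G = 0.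
Proof.
move=> MM exM GM; pose Mp := pinvmx M; pose k := (1%:M - M *m Mp) *m Mp.
have MMpM : M *m Mp *m M = M by rewrite mulmxKpV.
have sub : (1%:M - M *m Mp <= M)%MS.
  apply/row_subP => i; have [|v ->] := exM (row i (1%:M - M *m Mp)); last exact: submxMl.
  by rewrite -row_mul mulmxBl mul1mx MMpM subrr row0.
have kM : k *m M = 1%:M - M *m Mp by rewrite /k mulmxKpV.
have Mk : M *m k = M *m Mp.
  by rewrite /k mulmxA mulmxBr mulmx1 (mulmxA M M Mp) MM mul0mx subr0.
have -> : G = G *m (M *m k) + G *m (k *m M) by rewrite -mulmxDr kM Mk addrC subrK mulmx1.
clearbody k; rewrite mxtraceD (mulmxA G M k) GM (mulmxA G k M) mulNmx raddfN /=.
by rewrite (mxtrace_mulC (G *m k)) mulmxA addNr.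
Qed.

Variables (X : eqType) (V : zmodType) (co : V -> X -> K) (sc : K -> V -> V) (e : X -> V).
Variable d : {additive V -> V}.
Hypothesis coB : forall u v x, co (u - v) x = co u x - co v x.
Hypothesis coZ : forall c u x, co (sc c u) x = c * co u x.
Hypothesis dZ : forall c u, d (sc c u) = sc c (d u).
Hypothesis coE : forall x y, co (e x) y = (x == y)%:R.
Hypothesis co_inj : forall u v, (forall x, co u x = co v x) -> u = v.
Hypothesis dd : forall u, d (d u) = 0.
Variables (s : seq X) (sgn : X -> bool).
Hypothesis s_uniq : uniq s.
Hypothesis d_in : forall u, (forall x, x \in s -> co u x = 0) ->
  forall x, x \in s -> co (d u) x = 0.
Hypothesis d_out : forall u, (forall x, x \notin s -> co u x = 0) ->
  forall x, x \notin s -> co (d u) x = 0.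
Hypothesis d_odd : forall c u, (forall x, x \in s -> sgn x = c -> co u x = 0) ->
  forall x, x \in s -> sgn x = ~~ c -> co (d u) x = 0.
Hypothesis d_exact : forall u, (forall x, x \notin s -> co u x = 0) -> d u = 0 ->
  exists v, u = d v.

(** The Euler characteristic of a finite exact summand, as the trace of the sign matrix. The
    interface by coordinates is there because [fock] is a module over the polynomial ring, whereas
    the trace is taken over [K]. *)
Lemma supertrace_exact : \sum_(x <- s) (-1) ^+ (sgn x) = 0 :> K.
Proof.
case: s s_uniq d_in d_out d_odd d_exact => [|x0 s'] s'_uniq d_in' d_out' d_odd' d_exact'.
  by rewrite big_nil.
set t := x0 :: s' in s'_uniq d_in' d_out' d_odd' d_exact' *.
pose n := size t; pose el (i : 'I_n) := nth x0 t i.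
have el_in i : el i \in t by rewrite mem_nth.
have el_inj i j : (el i == el j) = (i == j) by rewrite nth_uniq.
have elP x : x \in t -> exists i, x = el i.
  by move=> xt; have xn : (index x t < n)%N;
    [rewrite index_mem | exists (Ordinal xn); rewrite /el nth_index].
have co0 x : co 0 x = 0 by rewrite -(subrr 0) coB subrr.
have coD u v x : co (u + v) x = co u x + co v x.
  by rewrite -[v]opprK coB -[- v]sub0r [in RHS]opprB subr0 coB co0 sub0r opprK.
have co_sum (F : 'I_n -> V) x : co (\sum_i F i) x = \sum_i co (F i) x.
  by elim/big_rec2: _ => [|i y w _ <-]; rewrite ?co0 // coD.
pose mk (u : 'rV[K]_n) := \sum_i sc (u 0 i) (e (el i)).
have co_mk u x : co (mk u) x = \sum_i u 0 i * (el i == x)%:R.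
  by rewrite co_sum; apply: eq_bigr => i _; rewrite coZ coE.
have co_mk_el u j : co (mk u) (el j) = u 0 j.
  rewrite co_mk (bigD1 j) //= eqxx mulr1 big1 ?addr0 // => i /negbTE.
  by rewrite el_inj => ->; rewrite mulr0.
have co_mk_out u x : x \notin t -> co (mk u) x = 0.
  move=> xt; rewrite co_mk big1 // => i _; case: eqP => [E|]; last by rewrite mulr0.
  by rewrite -E el_in in xt.
pose M : 'M[K]_n := \matrix_(i, j) co (d (e (el i))) (el j).
have co_dmk u j : co (d (mk u)) (el j) = (u *m M) 0 j.
  rewrite raddf_sum co_sum mxE; apply: eq_bigr => i _.
  by rewrite dZ coZ mxE.
have mkP u : (forall x, x \notin t -> co u x = 0) -> u = mk (\row_j co u (el j)).
  move=> u0; apply: co_inj => x; have [/elP [i ->]|xt] := boolP (x \in t).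
    by rewrite co_mk_el mxE.
  by rewrite u0 // co_mk_out.
have e_out i x : x \notin t -> co (e (el i)) x = 0.
  by move=> xt; rewrite coE; case: eqP => // E; rewrite -E el_in in xt.
pose G : 'M[K]_n := diag_mx (\row_i (-1) ^+ sgn (el i)).
have <- : \tr G = \sum_(x <- t) (-1) ^+ sgn x.
  rewrite mxtrace_diag (big_nth x0) big_mkord; apply: eq_bigr => i _.
  by rewrite mxE.
apply: (@mxtrace_exact n M G).
- apply/row_matrixP => i; rewrite row_mul row0; apply/rowP => j.
  rewrite -co_dmk mxE.
  have -> : mk (row i M) = d (e (el i)).
    rewrite [RHS]mkP; last exact/d_out'/e_out.
    by congr mk; apply/rowP => k; rewrite !mxE.
  by rewrite dd co0.
- move=> u uM; have dmk0 : d (mk u) = 0.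
    apply: co_inj => x; rewrite co0; have [/elP [i ->]|xt] := boolP (x \in t).
      by rewrite co_dmk uM mxE.
    by apply: d_out' => // y; apply: co_mk_out.
  have [v vE] := d_exact' _ (co_mk_out u) dmk0.
  (* The primitive may have components outside [s]; by [d_in] dropping them does not affect its
     differential inside [s]. *)
  exists (\row_j co v (el j)); apply/rowP => j; rewrite -co_dmk -co_mk_el vE.
  apply/eqP; rewrite -subr_eq0 -coB -raddfB; apply/eqP; apply: d_in' => // x /elP [i ->].
  by rewrite coB co_mk_el mxE subrr.
- apply/matrixP => i j; rewrite mul_diag_mx mul_mx_diag !mxE.
  have [E|ne] := eqVneq (sgn (el i)) (sgn (el j)).
    suff -> : co (d (e (el i))) (el j) = 0 by rewrite mulr0 mul0r oppr0.
    apply: (@d_odd' (~~ sgn (el i))) => //; last by rewrite negbK.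
    by move=> x _ xs; rewrite coE; case: eqP => // E'; rewrite -E' in xs; case: sgn xs.
  have -> : sgn (el i) = ~~ sgn (el j) by move: ne; do 2 case: sgn.
  by case: sgn; rewrite /=; ring.
Qed.
End Supertrace.

Section Grading.
Variables (S : comNzRingType) (a b : nat) (G : zmodType).
Local Notation A := (fock S a b).
(* [V t p]: the component of degree [t] of the scalar [p] vanishes. *)
Variable V : G -> S -> Prop.
Hypothesis V0 : forall t, V t 0.
Hypothesis VD : forall t p q, V t p -> V t q -> V t (p + q).
Hypothesis VN : forall t p, V t p -> V t (- p).
Variables (gv : 'I_a -> G) (gw : 'I_b -> G).

Definition gidx (x : 'I_(a + b)) : G :=
  match split x with inl k => gv k | inr l => gw l end.
Definition gmon (J : {set 'I_b}) (mu : 'X_{1..a}) : G :=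
  \sum_(l in J) gw l + \sum_k gv k *+ mu k.
Definition vanish (t : G) (phi : A) : Prop :=
  forall J mu, V (t - gmon J mu) (phi J)@_mu.

Lemma gmonU (l : 'I_b) (J : {set 'I_b}) mu : l \notin J ->
  gmon (l |: J) mu = gw l + gmon J mu.
Proof. by move=> lJ; rewrite /gmon big_setU1 //= addrA. Qed.

Lemma gmonX k (J : {set 'I_b}) mu : gmon J (mu + U_(k))%MM = gv k + gmon J mu.
Proof.
rewrite /gmon addrCA; congr (_ + _).
have -> : \sum_j gv j *+ (mu + U_(k))%MM j = \sum_j (gv j *+ mu j + gv j *+ (k == j)).
  by apply: eq_bigr => j _; rewrite mnmDE mnm1E mulrnDr.
rewrite big_split /= addrC; congr (_ + _).
rewrite (bigD1 k) //= eqxx mulr1n big1 ?addr0 // => j /negbTE.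
by rewrite eq_sym => ->.
Qed.

Lemma Vsign t n p : V t p -> V t ((-1) ^+ n * p).
Proof. by rewrite -signr_odd mulr_sign; case: odd => //; apply: VN. Qed.

Lemma Vmuln t n p : V t p -> V t (p *+ n).
Proof.
by move=> Vp; elim: n => [|n IH]; rewrite ?mulr0n ?mulrS; [exact: V0 | exact: VD].
Qed.

Lemma vanish0 t : vanish t 0.
Proof. by move=> J mu; rewrite ffunE mcoeff0. Qed.

Lemma vanishD t phi psi : vanish t phi -> vanish t psi -> vanish t (phi + psi).
Proof. by move=> H H' J mu; rewrite ffunE mcoeffD; apply: VD. Qed.

Lemma vanish_ann t x phi : vanish t phi -> vanish (t - gidx x) (ann x phi).
Proof.
move=> H J mu; rewrite /ann /gidx; case: split => k; rewrite ffunE.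
  by rewrite mcoeff_mderiv -addrA -opprD -gmonX; apply: Vmuln.
case: ifP => kJ; first by rewrite mcoeff0; apply: V0.
by rewrite mcoeffZ -addrA -opprD -gmonU ?kJ //; apply: Vsign.
Qed.

Lemma vanish_cre t x phi : vanish t phi -> vanish (t + gidx x) (cre x phi).
Proof.
move=> H J mu; rewrite /cre /gidx; case: split => k; rewrite ffunE.
  rewrite mcoeffXM; case: ifP => [/submK E|_]; last exact: V0.
  by rewrite -{1}E gmonX opprD addrA addrK.
case: ifP => kJ; last by rewrite mcoeff0; apply: V0.
rewrite mcoeffZ -{1}(setD1K kJ) gmonU ?setD11 // opprD addrA addrK.
exact: Vsign.
Qed.

(** Speaking of vanishing components rather than of homogeneous elements lets this one lemma, used
    with triples of length, degree and parity, give the stability of a strand, that of its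
    complement and the change of parity. *)
Lemma vanish_bil t dlt (X : 'M[S]_(a + b)) phi :
  (forall k l t' p, V t' p -> V (t' + (dlt + gidx k - gidx l)) (X k l * p)) ->
  vanish t phi -> vanish (t + dlt) (bil X phi).
Proof.
move=> hX H; rewrite /bil; elim/big_rec: _ => [|k u _]; first exact: vanish0.
apply: vanishD; elim/big_rec: _ => [|l w _]; first exact: vanish0.
apply: vanishD => J mu; rewrite ffunE mcoeffZ.
have -> : t + dlt - gmon J mu = (t - gidx k + gidx l - gmon J mu) + (dlt + gidx k - gidx l).
  by rewrite !addrA [RHS](+%R.[ACl 1*5*4*(6*2)*(3*7)]) /= !subrr !addr0.
apply: hX; apply: vanish_cre; exact: vanish_ann.
Qed.
End Grading.

Lemma sum_triple (U V W : zmodType) (I : Type) (r : seq I) (P : pred I)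
    (f : I -> U) (g : I -> V) (h : I -> W) :
  \sum_(i <- r | P i) ((f i, g i), h i) =
  ((\sum_(i <- r | P i) f i, \sum_(i <- r | P i) g i), \sum_(i <- r | P i) h i).
Proof. by elim: r => [|x r IH]; rewrite ?big_nil // !big_cons IH; case: (P x). Qed.

Lemma mulrn_triple (U V W : zmodType) (x : U) (y : V) (z : W) n :
  ((x, y), z) *+ n = ((x *+ n, y *+ n), z *+ n).
Proof. by elim: n => // n IH; rewrite !mulrS IH. Qed.

Lemma addr_triple (U V W : zmodType) (x x' : U) (y y' : V) (z z' : W) :
  ((x, y), z) + ((x', y'), z') = ((x + x', y + y'), z + z').
Proof. by []. Qed.

Lemma oppr_triple (U V W : zmodType) (x : U) (y : V) (z : W) :
  - ((x, y), z) = ((- x, - y), - z).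
Proof. by []. Qed.

Section Strand.
Variables (K : numFieldType) (m a b : nat).
Local Notation S := {mpoly K[m]}.
Variables (v : 'I_a -> int) (w : 'I_b -> int).

Lemma bil_sqr0 (T : idomainType) (D : 'M[T]_(a, b)) (E : 'M[T]_(b, a)) (phi : fock T a b) :
  (forall n, n.+1%:R != 0 :> T) -> D *m E = 0 -> E *m D = 0 ->
  bil (block_mx 0 D E 0) (bil (block_mx 0 D E 0) phi) = 0.
Proof.
move=> char0 DE ED; set d := block_mx _ _ _ _.
have dd : d *m d = 0.
  by rewrite /d mulmx_block DE ED !mulmx0 !mul0mx !addr0 block_mx_const.
rewrite bilM dd bil0 add0r; apply: (fock_scale_eq0 (c := 2%:R)); last exact: char0.
have := nordC phi (mxparity_odd D E) (mxparity_odd D E).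
rewrite /= expr1 scaleN1r -/d => /eqP; rewrite -addr_eq0 => /eqP <-.
by rewrite scaler_nat mulr2n.
Qed.

Lemma exact_of_homotopies (T : idomainType) (D : 'M[T]_(a, b)) (E : 'M[T]_(b, a)) r i n
    (f : nat -> T) (Q : nat -> T -> Prop) (quo rem : nat -> T -> T) (z : fock T a b) :
  (forall n, n.+1%:R \is a @GRing.unit T) ->
  (forall k, ideal_like (Q k)) -> (forall k, quo k 0 = 0) -> (forall k, rem k 0 = 0) ->
  (forall k p, (k < n)%N -> p = f k ^+ r.+1 * quo k p + rem k p) ->
  (forall k p, (k < n)%N -> Q k.+1 p -> Q k (rem k p)) ->
  (forall k p, (k < n)%N -> Q k (f k ^+ r.+1 * p) -> Q k p) ->
  (forall p, Q 0 p -> p = 0) -> D *m E = 0 -> E *m D = 0 ->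
  (forall k, (k < n)%N -> exists (H : 'M_(b, a)) (L : 'M_(a, b)) (P : 'M_b),
    [/\ f k != 0, D *m H + L *m E = (f k)%:M, E *m L + H *m D = (f k)%:M - P,
      D *m P = 0 /\ P *m E = 0 &
      P *m P = f k *: P /\ (\rank (map_mx (@tofrac T) P) <= r)%N]) ->
  (r < i)%N -> of_length i z -> bil (block_mx 0 D E 0) z = 0 -> coefs_in (Q n) z ->
  exists beta, z = bil (block_mx 0 D E 0) beta.
Proof.
move=> natU idQ quo0 rem0 qrE Qrem reg Q0 DE ED hP ri lz dz Qz.
have char0 k : k.+1%:R != 0 :> T.
  by apply: contraTneq (natU k) => ->; rewrite unitr0.
apply: (@descent T a b natU (block_mx 0 D E 0) r i n f Q quo rem) => //.
- by move=> phi; apply: bil_sqr0.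
- exact: mxparity_odd.
move=> k kn; have [H [L [P [fk DH EL [DP PE] [PP rkP]]]]] := hP k kn.
exists (block_mx 0 L H 0), (oddblock a P); split.
- exact: mxparity_odd.
- exact: mxparity_even.
- rewrite !mulmx_block !mulmx0 !mul0mx !add0r !addr0 add_block_mx !addr0 DH.
  rewrite EL /oddblock opp_block_mx !oppr0 scalar_mx_block add_block_mx !addr0.
  by [].
- by rewrite /oddblock !mulmx_block !mulmx0 !mul0mx !add0r DP PE block_mx_const.
- by move=> phi; apply: prodop_bil_rank.
Qed.

Definition fcoord (phi : fock S a b) (x : {set 'I_b} * 'X_{1..a} * 'X_{1..m}) : K :=
  ((phi x.1.1)@_(x.1.2))@_(x.2).

Definition mon_deg (J : {set 'I_b}) (mu : 'X_{1..a}) : int :=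
  \sum_(l in J) w l + \sum_k v k *+ mu k.

(* In every strand of large enough internal degree [e] and of length [i], there are as many
   monomials with an even as with an odd number of odd variables. *)
Definition strands_balanced (i : nat) : Prop :=
  exists D0 : nat, forall (e : int) (s : seq ({set 'I_b} * 'X_{1..a} * 'X_{1..m})),
    D0%:Z <= e -> uniq s ->
    (forall x, (x \in s) = (#|x.1.1| + mdeg x.1.2 == i)%N &&
                          (mon_deg x.1.1 x.1.2 + (mdeg x.2)%:Z == e)) ->
    \sum_(x <- s) (-1) ^+ odd #|x.1.1| = 0 :> K.

Lemma mon_deg_bound (J : {set 'I_b}) mu :
  (`|mon_deg J mu| <= \sum_l `|w l| + (#|J| + mdeg mu) * \sum_k `|v k|)%N.
Proof.
rewrite -lez_nat abszE PoszD PoszM !(raddf_sum Posz) /=.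
apply: le_trans (ler_normD _ _) _; apply: lerD.
  apply: le_trans (ler_norm_sum _ _ _) _.
  rewrite [leRHS](bigID (mem J)) /= -[leLHS]addr0; apply: lerD; last by apply: sumr_ge0.
  by apply: ler_sum => l _; rewrite abszE.
apply: le_trans (ler_norm_sum _ _ _) _; rewrite mulr_sumr; apply: ler_sum => k _.
rewrite normrMn abszE.
have : (mu k <= #|J| + mdeg mu)%N by rewrite mdegE (bigD1 k) //= addnCA leq_addr.
rewrite -mulr_natr natz mulrC; move=> h; apply: ler_wpM2r => //.
Qed.

Lemma strands_balanced_gt (D : 'M[S]_(a, b)) (E : 'M[S]_(b, a)) r i :
  (forall k l mu, (D k l)@_mu != 0 -> (mdeg mu)%:Z = v k - w l) ->
  (forall k l mu, (E l k)@_mu != 0 -> (mdeg mu)%:Z = w l - v k) ->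
  D *m E = 0 -> E *m D = 0 ->
  (forall k : 'I_m, exists (N : nat) (H : 'M_(b, a)) (L : 'M_(a, b)) (P : 'M_b),
    [/\ D *m H + L *m E = ('X_k ^+ N)%:M, E *m L + H *m D = ('X_k ^+ N)%:M - P,
      D *m P = 0 /\ P *m E = 0 &
      P *m P = 'X_k ^+ N *: P /\ (frac_rank P <= r)%N]) ->
  (r < i)%N -> strands_balanced i.
Proof.
move=> Dhom Ehom DE ED /choice[N hN] ri.
(* The exponent of the variable in [f ^+ r.+1], the element by which [descent] divides. *)
pose M (j : 'I_m) := (N j * r.+1)%N.
(* A word of length [i] has degree at most the two middle terms, so its coefficient monomials have
   degree above [\sum_j M j], and some exponent reaches its [M j]. *)
exists (\sum_j M j + \sum_l `|w l|%N + i * \sum_k `|v k|%N + 1)%N => e s D0e s_uniq s_in.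
(* Scalars have length 0 and even parity, so at any other [t] the condition is empty. *)
pose V (t : int * int * bool) (p : S) := forall mu, t = (0, (mdeg mu)%:Z, false) -> p@_mu = 0.
have V0 t : V t 0 by move=> mu _; rewrite mcoeff0.
have VD t p q : V t p -> V t q -> V t (p + q).
  by move=> Hp Hq mu tE; rewrite mcoeffD Hp // Hq // addr0.
have VN t p : V t p -> V t (- p).
  by move=> Hp mu tE; rewrite mcoeffN Hp // oppr0.
pose gv (k : 'I_a) : int * int * bool := (1, v k, false).
pose gw (l : 'I_b) : int * int * bool := (1, w l, true).
have gmonE J mu : gmon gv gw J mu = ((#|J| + mdeg mu)%N%:Z, mon_deg J mu, odd #|J|).
  rewrite /gmon /gw sum_triple /mon_deg.
  rewrite (eq_bigr (fun k => ((mu k)%:Z, v k *+ mu k, false))); last first.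
    move=> k _; rewrite /gv mulrn_triple; congr (_, _, _); first by rewrite pmulrn intz.
    by elim: (mu k) => // n IH; rewrite mulrS IH.
  rewrite sum_triple addr_triple; congr (_, _, _).
  - by rewrite sumr_const mdegE PoszD pmulrn intz raddf_sum.
  - by rewrite sumr_const big1 // addr0; elim: #|_| => // n; rewrite mulrS => ->.
pose X : eqType := ({set 'I_b} * 'X_{1..a} * 'X_{1..m})%type.
pose full (x : X) : int * int * bool := ((#|x.1.1| + mdeg x.1.2)%N%:Z,
  mon_deg x.1.1 x.1.2 + (mdeg x.2)%:Z, odd #|x.1.1|).
pose d := block_mx 0 D E 0.
have d_shift (t : int * int * bool) phi : vanish V gv gw t phi ->
    vanish V gv gw (t + (0, 0, true)) (bil d phi).
  apply: vanish_bil => // k l t' p Hp mu.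
  have Vmul (q : S) (g : int) t'' :
      (forall nu, q@_nu != 0 -> (mdeg nu)%:Z = g) -> t'' = t' + (0, g, false) -> V t'' (q * p).
    move=> qg -> {}mu E'; apply/eqP; apply: contraT; rewrite -mcoeff_msupp => /msuppM_le.
    case/allpairsP => -[m1 m2] /= []; rewrite !mcoeff_msupp => /qg m1g m2p muE.
    case/negP: m2p; apply/eqP; apply: Hp; apply: (addIr (0, g, false)); rewrite E' muE -m1g.
    by rewrite mdegD PoszD [in RHS]addrC.
  have Vmul0 t'' : V t'' (0 * p) by rewrite mul0r.
  have gl k' : gidx gv gw (lshift b k') = gv k' by rewrite /gidx (unsplitK (inl _)).
  have gr l' : gidx gv gw (rshift a l') = gw l' by rewrite /gidx (unsplitK (inr _)).
  move: mu; rewrite -/(V _ _) /d.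
  case: (split_ordP k) => k' ->; case: (split_ordP l) => l' ->;
    rewrite ?block_mxEul ?block_mxEur ?block_mxEdl ?block_mxEdr ?mxE // ?gl ?gr.
    apply: (Vmul _ (v k' - w l')) => [nu|]; first exact: Dhom.
    by rewrite /gv /gw oppr_triple !addr_triple add0r subrr add0r.
  apply: (Vmul _ (w k' - v l')) => [nu|]; first exact: Ehom.
  by rewrite /gv /gw oppr_triple !addr_triple add0r subrr add0r.
have fullE (x : X) : full x = gmon gv gw x.1.1 x.1.2 + (0, (mdeg x.2)%:Z, false).
  by rewrite gmonE addr_triple addr0; congr (_, _, _); case: odd.
have vanishP t phi : vanish V gv gw t phi <-> (forall x : X, full x = t -> fcoord phi x = 0).
  split=> H.
    by move=> x E'; apply: H; rewrite -E' fullE addrC addKr.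
  by move=> J mu nu E'; apply: (H (J, mu, nu)); rewrite fullE /= -E' addrC subrK.
pose sgn (x : X) := odd #|x.1.1|.
have s_inP x : reflect (full x = (i%:Z, e, sgn x)) (x \in s).
  rewrite s_in; apply: (iffP andP) => [[/eqP E1 /eqP E2]|[] E1 E2 ].
    by rewrite /full E1 E2.
  by rewrite E2 -eqz_nat E1.
pose sc (c : K) (phi : fock S a b) := c%:MP *: phi.
pose be (x : X) : fock S a b :=
  [ffun J => if J == x.1.1 then 'X_[x.2] *: 'X_[x.1.2] else 0].
apply: (@supertrace_exact K _ (fock S a b) fcoord sc be (bil d) _ _ _ _ _ _ s sgn) => //.
- by move=> p q x; rewrite /fcoord !ffunE !mcoeffB.
- by move=> c p x; rewrite /fcoord !ffunE mcoeffZ mcoeffCM.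
- by move=> c p; exact: (linearZ_LR (bil d)).
- move=> [[J mu] nu] [[J' mu'] nu']; rewrite /fcoord ffunE /= !xpair_eqE.
  rewrite [J' == J]eq_sym; case: eqP => [_|_] /=; last by rewrite !mcoeff0.
  rewrite mcoeffZ mcoeffX; case: eqP => _ /=; last by rewrite mulr0 mcoeff0.
  by rewrite mulr1 mcoeffX.
- move=> p q pq; apply/ffunP => J; apply/mpolyP => mu; apply/mpolyP => nu.
  exact: (pq (J, mu, nu)).
- move=> p; apply: bil_sqr0 => // n.
  by rewrite -mpolyC_nat mpolyC_eq0 pnatr_eq0.
- move=> p Hp x /[dup] xs /s_inP xE; move: (d_shift (i%:Z, e, ~~ sgn x) p) => /(_ _)/vanishP; apply.
    by apply/vanishP => y yE; apply: Hp; apply/s_inP; rewrite yE; case: yE => _ _ <-.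
  by rewrite xE addr_triple !addr0; case: (sgn x).
- move=> p Hp x /negP xs.
  move: (d_shift (full x + (0, 0, true)) p) => /(_ _)/vanishP; apply.
    apply/vanishP => y yE; apply: Hp; apply/s_inP => yE'; apply: xs; apply/s_inP.
    move: yE; rewrite yE' /full addr_triple !addr0 => -[<- <- _].
    by [].
  by rewrite -addrA addr_triple !addr0.
- move=> c p Hp x xs xc.
  move: (d_shift (i%:Z, e, c) p) => /(_ _)/vanishP; apply.
    apply/vanishP => y yE; apply: Hp; first by apply/s_inP; rewrite yE; case: yE => _ _ <-.
    by case: yE.
  by move/s_inP: xs => ->; rewrite xc addr_triple !addr0; case: (c).
move=> p p_out dp.
have lp : of_length i p.
  move=> J mu ne; apply/mpolyP => nu; rewrite mcoeff0; apply: (p_out (J, mu, nu)).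
  by rewrite s_in /= (negbTE ne).
pose f (k : nat) : S := oapp (fun k' : 'I_m => 'X_k' ^+ N k') 0 (insub k).
pose quo (k : nat) : S -> S := oapp (fun k' : 'I_m => mquo k' (M k')) id (insub k).
pose rem (k : nat) : S -> S := oapp (fun k' : 'I_m => mrem k' (M k')) id (insub k).
have insubm k : (k < m)%N -> exists2 k' : 'I_m, k = k' & insub k = Some k'.
  by move=> km; exists (Ordinal km) => //; rewrite insubT.
apply: (@exact_of_homotopies _ D E r i m f (gen_ideal M) quo rem) => //.
- by move=> n; rewrite -mpolyC_nat; apply: rmorph_unit; rewrite unitfE pnatr_eq0.
- exact: gen_ideal_like.
- by move=> k; rewrite /quo; case: insub => //= k'; rewrite /mquo msupp0 big_nil.
- by move=> k; rewrite /rem; case: insub => //= k'; rewrite /mrem msupp0 big_nil.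
- move=> k q /insubm [k' _ E']; rewrite /f /quo /rem E' /= -exprM.
  exact: mquo_rem.
- by move=> k q /insubm [k' -> E'] Hq; rewrite /rem E' /=; apply: gen_ideal_mrem.
- move=> k q /insubm [k' -> E']; rewrite /f E' /= -exprM.
  exact: gen_ideal_reg.
- move=> q Hq; apply/mpolyP => mu; rewrite mcoeff0; apply/eqP; apply: contraT => /Hq [j].
  by rewrite ltn0.
- move=> k /insubm [k' _ E']; have [H [L [P [DH EL DP PP]]]] := hN k'.
  exists H, L, P; rewrite /f E' /=; split=> //.
  by rewrite mpolyXn -msupp_eq0 msuppX.
move=> J mu nu nz.
have : (J, mu, nu) \in s.
  by apply: contraT => /p_out; rewrite /fcoord /= => E'; rewrite E' eqxx in nz.
rewrite s_in /= => /andP[/eqP len /eqP deg].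
apply/existsP; apply: contraT; rewrite negb_exists => /forallP small.
suff : e < (\sum_j M j + \sum_l `|w l|%N + i * \sum_k `|v k|%N + 1)%N%:Z.
  by rewrite ltNge D0e.
rewrite -deg /mon_deg.
have degnu : (mdeg nu <= \sum_j M j)%N.
  rewrite mdegE; apply: leq_sum => j _; move: (small j).
  by rewrite ltn_ord /= -ltnNge => /ltnW.
have := mon_deg_bound J mu; rewrite len /mon_deg; lia.
Qed.
End Strand.

(** * From dimensions to leading terms *)

Section GeomDiv.
Variable R : comNzRingType.

Definition geom (t : R) (M : nat) : {poly R} := \sum_(j < M) (t *: 'X) ^+ j.

Lemma prod_geom (I : Type) (s : seq I) (t : I -> R) M : exists C : {poly R},
  \prod_(k <- s) (1 - t k *: 'X) * \prod_(k <- s) geom (t k) M = 1 + C * 'X^M.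
Proof.
elim: s => [|k s [C CE]]; first by exists 0; rewrite !big_nil mul0r addr0 mulr1.
rewrite !big_cons mulrACA CE.
have -> : (1 - t k *: 'X) * geom (t k) M = 1 - (t k ^+ M)%:P * 'X^M.
  by rewrite /geom -opprB mulNr -subrX1 opprB exprZn mul_polyC.
exists (C - (t k ^+ M)%:P - (t k ^+ M)%:P * C * 'X^M); ring.
Qed.

(** The truncated geometric series invert the denominator modulo ['X^M]. If the quotient has no
    terms between [r] and [M], both sides have degree below [M], so the congruence is an
    equality. *)
Lemma geom_div (I : Type) (s : seq I) (t : I -> R) (N : {poly R}) M r
    (Y := N * \prod_(k <- s) geom (t k) M) :
  (size N <= M)%N -> (size s + r < M)%N ->
  (forall i, (r < i < M)%N -> Y`_i = 0) ->
  N = \prod_(k <- s) (1 - t k *: 'X) * take_poly r.+1 Y.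
Proof.
move=> sN sr Y0; have [C CE] := prod_geom s t M.
set V := \prod_(k <- s) _ in CE *.
have sV : (size V <= (size s).+1)%N.
  rewrite /V; elim: {CE sr Y0 Y V C} s => [|k s IH]; first by rewrite big_nil size_polyC oner_eq0.
  rewrite big_cons; apply: leq_trans (size_polyMleq _ _) _.
  have : (size (1 - t k *: 'X)%R <= 2)%N.
    rewrite (leq_trans (size_polyD _ _)) // geq_max size_polyC oner_eq0 size_polyN /=.
    by rewrite (leq_trans (size_scale_leq _ _)) // size_polyX.
  by move/leq_add => /(_ _ _ IH); rewrite /= => H; rewrite -subn1 leq_subLR.
have YE : Y = take_poly r.+1 Y + drop_poly M Y * 'X^M.
  rewrite -{1}[Y](poly_take_drop M); congr (_ + _); apply/polyP => i.
  rewrite !coef_take_poly; case: (ltnP i r.+1) => ir; first by rewrite (leq_trans ir) //; lia.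
  by case: ltnP => // iM; apply: Y0; rewrite ir.
have E : N + N * C * 'X^M = V * take_poly r.+1 Y + V * drop_poly M Y * 'X^M.
  by rewrite -[V * _ * _]mulrA -mulrDr -YE /Y mulrCA CE mulrDr mulr1 mulrA.
apply/polyP => i; have [iM|Mi] := ltnP i M; last first.
  rewrite [LHS]nth_default ?(leq_trans sN) // nth_default //.
  apply: leq_trans (leq_trans (size_polyMleq _ _) _) Mi.
  move: sV sr (size_take_poly r.+1 Y).
  by move: (size V) (size (take_poly _ _)) (size s) => x y z; lia.
by move: (congr1 (fun p : {poly R} => p`_i) E); rewrite !coefD !coefMXn iM !addr0.
Qed.
End GeomDiv.

(** * The substitution y = z / (1 + z), without denominators *)

Section Homogenize.
Variable R : comNzRingType.

(* The value of the degree [n] homogenization of [p] at [('X, 1 + 'X)]. *)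
Definition homz n (p : {poly R}) : {poly R} :=
  \sum_(i < n.+1) p`_i *: ('X^i * (1 + 'X) ^+ (n - i)).

Lemma homzM n1 n2 (p q : {poly R}) : (size p <= n1.+1)%N -> (size q <= n2.+1)%N ->
  homz (n1 + n2) (p * q) = homz n1 p * homz n2 q.
Proof.
move=> sp sq.
have homz_sum n (I : finType) (F : I -> {poly R}) : homz n (\sum_i F i) = \sum_i homz n (F i).
  rewrite /homz exchange_big; apply: eq_bigr => i _ /=.
  by rewrite coef_sum scaler_suml.
have homzX n k c : (k <= n)%N -> homz n (c *: 'X^k) = c *: ('X^k * (1 + 'X) ^+ (n - k)).
  move=> kn; have kn' : (k < n.+1)%N by [].
  rewrite /homz (bigD1 (Ordinal kn')) //= coefZ coefXn eqxx mulr1 big1 ?addr0 // => i ne.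
  by rewrite coefZ coefXn (negbTE ne : (i == k :> nat) = false) mulr0 scale0r.
have polyE n (f : {poly R}) : (size f <= n.+1)%N -> f = \sum_(i < n.+1) f`_i *: 'X^i.
  move=> sf; rewrite -{1}(take_poly_id sf); apply/polyP => i.
  rewrite coef_take_poly coef_sum; case: ltnP => [ilt|le].
    rewrite (bigD1 (Ordinal ilt)) //= coefZ coefXn eqxx mulr1 big1 ?addr0 // => j ne.
    by rewrite coefZ coefXn eq_sym (negbTE ne : (j == i :> nat) = false) mulr0.
  rewrite big1 // => j _; rewrite coefZ coefXn gtn_eqF ?mulr0 //.
  exact: leq_trans (ltn_ord j) le.
have -> : p * q = \sum_(i < n1.+1) \sum_(j < n2.+1) (p`_i * q`_j) *: 'X^(i + j).
  rewrite [in LHS](polyE _ _ sp) [in LHS](polyE _ _ sq) big_distrl; apply: eq_bigr => i _ /=.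
  rewrite big_distrr; apply: eq_bigr => j _ /=.
  by rewrite -scalerAl -scalerAr scalerA -exprD.
rewrite homz_sum /homz [RHS]big_distrl; apply: eq_bigr => i _.
rewrite -/(homz _ _) homz_sum big_distrr; apply: eq_bigr => j _ /=.
have il := ltn_ord i; have jl := ltn_ord j.
rewrite homzX; last by move: (nat_of_ord i) (nat_of_ord j) il jl => x y; lia.
rewrite -scalerAl -scalerAr scalerA; congr (_ *: _).
rewrite mulrACA -!exprD; congr (_ * _ ^+ _).
by move: (nat_of_ord i) (nat_of_ord j) il jl => x y; lia.
Qed.

Lemma size_homz n (p : {poly R}) : (size (homz n p) <= n.+1)%N.
Proof.
apply: leq_trans (size_sum _ _ _) _; apply/bigmax_leqP => i _.
apply: leq_trans (size_scale_leq _ _) _.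
apply: leq_trans (size_polyMleq _ _) _; rewrite size_polyXn /=.
have := size_poly_exp_leq (1 + 'X : {poly R}) (n - i).
rewrite addrC size_XaddC /= mul1n; have := ltn_ord i.
set x := size _; clearbody x; move: (nat_of_ord i) => y; lia.
Qed.

Lemma homz1 c : homz 1 (1 - c *: 'X) = 1 + (1 - c) *: 'X.
Proof.
rewrite /homz !big_ord_recl big_ord0 addr0 /= !coefB !coefZ !coef1 !coefX /=.
rewrite -!mul_polyC !polyCB /= !polyCM polyC1 polyC0; ring.
Qed.

End Homogenize.

Section UnitProd.
Variable R : comUnitRingType.

(** The unit coefficients keep degrees additive although the ring may have nilpotent elements. *)
Lemma size_prod_unit (I : Type) (s : seq I) (t : I -> R) :
  (forall k, t k \is a GRing.unit) ->
  size (\prod_(k <- s) (1 - t k *: 'X)) = (size s).+1 /\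
  lead_coef (\prod_(k <- s) (1 - t k *: 'X)) \is a GRing.unit.
Proof.
move=> tU; elim: s => [|k s [IHs IHl]].
  by rewrite big_nil size_polyC oner_eq0 lead_coefC unitr1.
have t0 : t k != 0 by apply: contraTneq (tU k) => ->; rewrite unitr0.
have szt : size (- (t k *: 'X)) = 2.
  by rewrite size_polyN -mul_polyC size_mulX ?polyC_eq0 // size_polyC t0.
have sz1 : (size (1%R : {poly R}) < size (- (t k *: 'X))%R)%N by rewrite szt size_polyC oner_eq0.
have szp : size (1 - t k *: 'X) = 2 by rewrite addrC size_polyDl.
have lcp : lead_coef (1 - t k *: 'X) = - t k.
  by rewrite addrC lead_coefDl // lead_coefE szt coefN coefZ coefX mulr1.
have lcM : lead_coef (1 - t k *: 'X) * lead_coef (\prod_(k <- s) (1 - t k *: 'X)) \is a GRing.unit.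
  by rewrite lcp unitrM unitrN tU.
have lc0 : lead_coef (1 - t k *: 'X) * lead_coef (\prod_(k <- s) (1 - t k *: 'X)) != 0.
  by apply: contraTneq lcM => ->; rewrite unitr0.
rewrite big_cons size_proper_mul // lead_coef_proper_mul // szp IHs; split=> //.
Qed.

Lemma homz_prod (I : Type) (s : seq I) (t : I -> R) :
  (forall k, t k \is a GRing.unit) ->
  homz (size s) (\prod_(k <- s) (1 - t k *: 'X)) = \prod_(k <- s) (1 + (1 - t k) *: 'X).
Proof.
move=> tU; elim: s => [|k s IH].
  by rewrite !big_nil /homz big_ord1 coef1 scale1r expr0 mulr1.
rewrite !big_cons -[size (k :: s)]/(1 + size s)%N homzM ?homz1 ?IH //.
  by have [] := size_prod_unit [:: k] tU; rewrite big_seq1 => ->.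
by have [->] := size_prod_unit s tU.
Qed.

(** Unit leading coefficients force [size s] to be [size s'] plus the degree of [Q]; homogenizing
    each factor in its exact degree, the powers of [1 + 'X] balance. *)
Lemma homz_factor (I J : Type) (s : seq I) (s' : seq J) (t : I -> R) (t' : J -> R) Q r :
  (forall k, t k \is a GRing.unit) -> (forall k, t' k \is a GRing.unit) ->
  \prod_(k <- s) (1 - t k *: 'X) = \prod_(k <- s') (1 - t' k *: 'X) * Q ->
  (size Q <= r.+1)%N -> exists2 Q' : {poly R}, (size Q' <= r.+1)%N &
  \prod_(k <- s) (1 + (1 - t k) *: 'X) = \prod_(k <- s') (1 + (1 - t' k) *: 'X) * Q'.
Proof.
move=> tU tU' E sQ; have [szs _] := size_prod_unit s tU; have [szs' lcs'] := size_prod_unit s' tU'.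
have Q0 : Q != 0.
  by apply: contraTneq (leqnn (size (\prod_(k <- s) (1 - t k *: 'X)))); 
    rewrite {1}szs E => ->; rewrite mulr0 size_poly0.
have lc0 : lead_coef (\prod_(k <- s') (1 - t' k *: 'X)) * lead_coef Q != 0.
  by rewrite mulrI_eq0 ?lead_coef_eq0 //; apply: mulrI.
have sE : size s = (size s' + (size Q).-1)%N.
  have : size Q != 0%N by rewrite size_poly_eq0.
  by have := size_proper_mul lc0; rewrite -E szs szs'; case: (size Q) => //= q; lia.
exists (homz (size Q).-1 Q).
  by apply: leq_trans (size_homz _ _) _; rewrite prednK ?size_poly_gt0.
by rewrite -homz_prod // E sE homzM ?szs' ?homz_prod // prednK ?size_poly_gt0.
Qed.
End UnitProd.

(** * Leading terms in tau *)

Section LeadingTerms.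
Variables (B : comUnitRingType) (tau : B) (m : nat).
Hypothesis tau_free : forall (x : int) i c, (i < m)%N ->
  x%:~R * tau ^+ i = c * tau ^+ i.+1 -> x = 0.
Hypothesis sU : (1 - tau) \is a GRing.unit.

(** For [i < m], [tau_free] makes [x] unique; this turns congruences in [B] into identities of
    integers. *)
Definition leads i (x : int) (y : B) : Prop := exists c, y = x%:~R * tau ^+ i + c * tau ^+ i.+1.

Lemma leads0 i : leads i 0 0.
Proof. by exists 0; rewrite !mul0r addr0. Qed.

Lemma leadsD i x x' y y' : leads i x y -> leads i x' y' -> leads i (x + x') (y + y').
Proof. by move=> [c ->] [c' ->]; exists (c + c'); rewrite intrD; ring. Qed.

Lemma leadsN i x y : leads i x y -> leads i (- x) (- y).
Proof. by move=> [c ->]; exists (- c); rewrite intrN; ring. Qed.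

Lemma leads_sum i (I : Type) (s : seq I) (f : I -> int) (g : I -> B) :
  (forall j, leads i (f j) (g j)) -> leads i (\sum_(j <- s) f j) (\sum_(j <- s) g j).
Proof.
move=> H; elim: s => [|j s IH]; first by rewrite !big_nil; apply: leads0.
by rewrite !big_cons; apply: leadsD.
Qed.

Lemma leadsM i j x x' y y' : leads i x y -> leads j x' y' -> leads (i + j) (x * x') (y * y').
Proof.
move=> [c ->] [c' ->]; exists (x%:~R * c' + c * x'%:~R + c * c' * tau).
by rewrite intrM !exprS !exprD; ring.
Qed.

Lemma leads_inj i x x' y : (i < m)%N -> leads i x y -> leads i x' y -> x = x'.
Proof.
move=> im [c ->] [c' E]; apply/eqP; rewrite -subr_eq0; apply/eqP.
apply: (@tau_free _ i (c' - c)) => //.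
transitivity (x%:~R * tau ^+ i + c * tau ^+ i.+1 - x'%:~R * tau ^+ i - c * tau ^+ i.+1).
  by rewrite intrB; ring.
by rewrite E; ring.
Qed.

Lemma leads_expn (n : nat) : leads 1 n (1 - (1 - tau) ^+ n).
Proof.
elim: n => [|n [c E]]; first by rewrite expr0 subrr; apply: leads0.
rewrite exprSr; have -> : (1 - tau) ^+ n = 1 - (n%:~R * tau ^+ 1 + c * tau ^+ 2).
  by rewrite -E opprB [RHS]addrC subrK.
by exists (c - n%:~R - c * tau); rewrite [n.+1%:~R](_ : _ = 1 + n%:~R) ?intS ?intrD //; ring.
Qed.

(** A negative exponent reduces to a positive one by [1 - g^-1 = - (1 - g) * g^-1], where [g^-1] is
    1 modulo [tau]. *)
Lemma leads_exp (w : int) : leads 1 w (1 - (1 - tau) ^ w).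
Proof.
case: w => n; first exact: leads_expn.
rewrite NegzE -exprnN; have [c E] := leads_expn n.+1.
set g := _ ^+ n.+1 in E *; have gU : g \is a GRing.unit by rewrite unitrX.
exists (- c - (n.+1%:~R + c * tau) * (n.+1%:~R + c * tau) * g^-1).
have g1 : g^-1 = 1 + (1 - g) * g^-1 by rewrite mulrBl mul1r divrr // addrC subrK.
have -> : 1 - g^-1 = - (1 - g) * g^-1 by rewrite opprB mulrBl mul1r divrr.
rewrite {1}g1 mulrDr mulr1 mulrA E; rewrite intrN; ring.
Qed.

Definition leadsp (p : {poly int}) (q : {poly B}) : Prop := forall i, leads i p`_i q`_i.

(** Each ['X] carries a factor of order [tau], so the coefficient of ['X^i] starts at [tau^i]. *)
Lemma leadsp_prod (s : seq int) :
  leadsp (\prod_(w <- s) (1 + w *: 'X)) (\prod_(w <- s) (1 + (1 - (1 - tau) ^ w) *: 'X)).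
Proof.
have l1 : leads 0 1 1 by exists 0; rewrite expr0 mulr1 mul0r addr0.
elim: s => [|w s IH] i.
  by rewrite !big_nil !coef1; case: i => [|i] //=; apply: leads0.
rewrite !big_cons !coefM; apply: leads_sum => j.
have ji : (j <= i)%N by rewrite -ltnS.
rewrite -{1}(subnKC ji); apply: leadsM; last exact: IH.
rewrite !coefD !coefZ !coef1 !coefX.
case: (nat_of_ord j) => [|[|k]] /=.
- by rewrite !mulr0 !addr0.
- by rewrite !mulr1 !add0r; apply: leads_exp.
- by rewrite !mulr0 !addr0; apply: leads0.
Qed.

Lemma leading_terms (vs ws : seq int) (Q : {poly B}) r (u : nat -> int) :
  \prod_(w <- ws) (1 + (1 - (1 - tau) ^ w) *: 'X) =
  \prod_(v <- vs) (1 + (1 - (1 - tau) ^ v) *: 'X) * Q ->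
  (size Q <= r.+1)%N -> u 0%N = 1 ->
  (forall i, (1 <= i <= r)%N -> (\prod_(w <- ws) (1 + w *: 'X))`_i =
      \sum_(0 <= j < i.+1) (\prod_(v <- vs) (1 + v *: 'X))`_j * u (i - j)%N) ->
  (forall j, (r < j)%N -> u j = 0) ->
  forall i, (r < i < m)%N -> (\prod_(w <- ws) (1 + w *: 'X))`_i =
      \sum_(0 <= j < i.+1) (\prod_(v <- vs) (1 + v *: 'X))`_j * u (i - j)%N.
Proof.
move=> E sQ u0 urec ubig.
have lW := leadsp_prod ws; have lV := leadsp_prod vs.
set W := \prod_(w <- ws) (1 + w *: 'X) in urec lW *.
set V := \prod_(v <- vs) (1 + v *: 'X) in urec lV *.
set W' := \prod_(w <- ws) _ in E lW; set V' := \prod_(v <- vs) _ in E lV.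
have c0 (R : comNzRingType) (f : int -> R) (s : seq int) : (\prod_(w <- s) (1 + f w *: 'X))`_0 = 1.
  elim: s => [|w s IH]; first by rewrite big_nil coef1.
  by rewrite big_cons coef0M IH coefD coef1 coefZ coefX mulr0 addr0 mulr1.
have W0 : W`_0 = 1 := c0 _ id ws. have V0 : V`_0 = 1 := c0 _ id vs.
have V'0 : V'`_0 = 1 := c0 _ _ vs.
(* Up to [r] both sequences obey the same recursion, solved for the term with [V_0 = 1]; beyond [r]
   both are zero. *)
have lQ i : leads i (u i) Q`_i.
  elim/ltn_ind: i => i IH; have [ir|ri] := leqP i r; last first.
    by rewrite ubig // nth_default ?(leq_trans sQ) //; apply: leads0.
  have -> : Q`_i = W'`_i - \sum_(j < i) V'`_(j.+1) * Q`_(i - j.+1).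
    by rewrite E coefM big_ord_recl /= subn0 V'0 mul1r addrK.
  have -> : u i = W`_i - \sum_(j < i) V`_(j.+1) * u (i - j.+1)%N.
    case: i ir {IH} => [|i] ir; first by rewrite big_ord0 subr0 u0 W0.
    by rewrite urec // big_mkord big_ord_recl /= subn0 V0 mul1r addrK.
  apply: leadsD => //; apply: leadsN; apply: leads_sum => j.
  have ji := ltn_ord j; rewrite -{1}(subnKC ji); apply: leadsM => //.
  by apply: IH; rewrite ltn_subrL /= (leq_ltn_trans _ ji).
move=> i /andP[ri im]; apply: (leads_inj im (lW i)).
rewrite E coefM big_mkord; apply: leads_sum => j.
have ji : (j <= i)%N by rewrite -ltnS.
by rewrite -{1}(subnKC ji); apply: leadsM.
Qed.
End LeadingTerms.

(** * Alternating sums over words and divisibility by (1 - s)^m *)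

Section StrandPoly.
Variables (K : numFieldType) (m a b : nat) (v : 'I_a -> int) (w : 'I_b -> int) (i M0 c : nat).
Hypothesis iM0 : (i < M0)%N.

Definition ffmon n M (al : {ffun 'I_n -> 'I_M}) : 'X_{1..n} := [multinom (al k : nat) | k < n].

Lemma ffmon_inj n M : injective (@ffmon n M).
Proof.
move=> al be E; apply/ffunP => k; apply: val_inj.
by move/mnmP/(_ k): E; rewrite !mnmE.
Qed.

Lemma ffmonP n M (mu : 'X_{1..n}) : (mdeg mu < M)%N ->
  exists al : {ffun 'I_n -> 'I_M}, mu = ffmon al.
Proof.
move=> muM; have lt k : (mu k < M)%N.
  by apply: leq_ltn_trans muM; rewrite mdegE (bigD1 k) //= leq_addr.
exists [ffun k => Ordinal (lt k)]; apply/mnmP => k.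
by rewrite mnmE ffunE.
Qed.

Lemma prod_geom_mon (R : comNzRingType) n M (t : 'I_n -> R) :
  \prod_k geom (t k) M = \sum_(al : {ffun 'I_n -> 'I_M}) 
    (\prod_k t k ^+ al k) *: 'X^(mdeg (ffmon al)).
Proof.
rewrite /geom bigA_distr_bigA; apply: eq_bigr => al _ /=.
under eq_bigr do rewrite exprZn -mul_polyC.
rewrite big_split /= -rmorph_prod mul_polyC; congr (_ *: _).
by rewrite prodrXr mdegE; congr (_ ^+ _); apply: eq_bigr => k _; rewrite mnmE.
Qed.

Definition koszul_idx : pred ({set 'I_b} * {ffun 'I_a -> 'I_M0}) :=
  [pred p : {set 'I_b} * {ffun 'I_a -> 'I_M0} | (#|p.1| + mdeg (ffmon p.2) == i)%N].

Definition shdeg (p : {set 'I_b} * {ffun 'I_a -> 'I_M0}) : nat :=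
  absz (mon_deg v w p.1 (ffmon p.2) + c%:Z).

(** Divided by [(1 - 'X) ^+ m], the left side has as coefficient of ['X^n] the signed count of the
    strand of degree [n - c]. These vanish for [n > D0 + c], so the quotient is a polynomial. The
    shift [c] makes the exponents nonnegative. *)
Lemma strand_poly :
  strands_balanced K m v w i ->
  (forall (J : {set 'I_b}) mu, (#|J| + mdeg mu)%N = i -> 0 <= mon_deg v w J mu + c%:Z) ->
  exists Q : {poly K},
    \sum_(p | koszul_idx p) (-1) ^+ odd #|p.1| *: 'X^(shdeg p) =
    (1 - 'X) ^+ m * Q.
Proof.
move=> [D0 H] hc; set N := \sum_(p | _) _.
pose M := (size N + m + (D0 + c)).+1.
exists (take_poly (D0 + c).+1 (N * \prod_(k <- enum 'I_m) geom 1 M)).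
have -> : (1 - 'X) ^+ m = \prod_(k <- enum 'I_m) (1 - 1 *: 'X) :> {poly K}.
  by rewrite big_enum /= prodr_const card_ord scale1r.
apply: geom_div; rewrite ?size_enum_ord;
  [by rewrite /M -addnA -addnS leq_addr | by rewrite /M ltnS -addnA leq_addl |].
move=> n /andP[n1 nM].
rewrite big_enum /= prod_geom_mon /N big_distrl /= coef_sum.
pose T : finType := ({set 'I_b} * {ffun 'I_a -> 'I_M0} * {ffun 'I_m -> 'I_M})%type.
pose P : pred T := [pred x | koszul_idx x.1 &&
  (shdeg x.1 + mdeg (ffmon x.2) == n)%N].
pose io (x : T) := (x.1.1, ffmon x.1.2, ffmon x.2).
have io_inj : injective io.
  move=> [[J al] mu] [[J' al'] mu'] /eqP; rewrite !xpair_eqE /=.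
  by case/andP=> /andP[/eqP -> /eqP/ffmon_inj ->] /eqP/ffmon_inj ->.
have absE (J : {set 'I_b}) mu : (#|J| + mdeg mu)%N = i ->
    (absz (mon_deg v w J mu + c%:Z))%:Z = mon_deg v w J mu + c%:Z.
  by move=> /hc; case: (_ + _).
have D0n : D0%:Z <= n%:Z - c%:Z by lia.
have u : uniq [seq io x | x <- enum P] by rewrite map_inj_uniq ?enum_uniq.
have key : \sum_(x | P x) (-1) ^+ odd #|x.1.1| = 0 :> K.
  have := H _ _ D0n u; rewrite big_map big_enum /= => -> //.
  move=> [[J mu] nu] /=; apply/mapP/andP => [[[[J' al] be]]|].
    rewrite mem_enum inE /= => /andP[/eqP len /eqP deg] [-> -> ->].
    split; first exact/eqP.
    by apply/eqP; have := absE _ _ len; move: deg; rewrite /shdeg /=; lia.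
  case=> /eqP len /eqP deg.
  have [al alE] : exists al : {ffun 'I_a -> 'I_M0}, mu = ffmon al.
    by apply: ffmonP; apply: leq_ltn_trans iM0; rewrite -len leq_addl.
  have [be beE] : exists be : {ffun 'I_m -> 'I_M}, nu = ffmon be.
    by apply: ffmonP; have := hc _ _ len; move: nM deg; lia.
  exists (J, al, be); last by rewrite alE beE.
  rewrite mem_enum inE /=; apply/andP; split; first by rewrite /koszul_idx /= -alE len.
  by have := absE _ _ len; move: deg; rewrite /shdeg /= -alE -beE; lia.
rewrite -[RHS]key.
transitivity (\sum_(p | koszul_idx p)
    \sum_(be : {ffun 'I_m -> 'I_M} | (shdeg p + mdeg (ffmon be) == n)%N)
    ((-1) ^+ odd #|p.1| : K)); last by rewrite pair_big_dep.
apply: eq_bigr => p _; rewrite big_distrr /= coef_sum [RHS]big_mkcond; apply: eq_bigr => be _.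
rewrite big1 => [|k _]; last by rewrite expr1n.
rewrite scale1r -scalerAl -exprD coefZ coefXn eq_sym; case: eqP => _; rewrite ?mulr1 ?mulr0 //.
Qed.
End StrandPoly.

Section KoszulFactor.
Variables (K : numFieldType) (B : comUnitRingType) (phi : {rmorphism {poly K} -> B}).
Variables (m a b : nat) (v : 'I_a -> int) (w : 'I_b -> int) (i : nat).
Let s := phi 'X.
Hypothesis sU : s \is a GRing.unit.
Hypothesis s_nil : (1 - s) ^+ m = 0.

Lemma mon_deg_expr (J : {set 'I_b}) M (al : {ffun 'I_a -> 'I_M}) :
  (\prod_(l in J) s ^ w l) * (\prod_k (s ^ v k) ^+ al k) = s ^ mon_deg v w J (ffmon al).
Proof.
have expr_sum (I : finType) (P : pred I) (f : I -> int) :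
    s ^ (\sum_(k | P k) f k) = \prod_(k | P k) s ^ f k.
  by elim/big_rec2: _ => [|k x y _ IH]; rewrite ?expr0z // exprzDr // IH.
rewrite exprzDr // !expr_sum; congr (_ * _); apply: eq_bigr => k _.
by rewrite mnmE exprnP exprz_exp -mulr_natr natz.
Qed.

Definition koszul_prod (M : nat) : {poly B} :=
  \prod_(l <- enum 'I_b) (1 - s ^ w l *: 'X) * \prod_(k <- enum 'I_a) geom (s ^ v k) M.

Lemma coef_koszul_prod M : (koszul_prod M)`_i =
  \sum_(p | @koszul_idx a b i M p) (-1) ^+ odd #|p.1| * s ^ mon_deg v w p.1 (ffmon p.2).
Proof.
rewrite /koszul_prod !big_enum /= prod_geom_mon.
have -> : \prod_l (1 - s ^ w l *: 'X) =
    \sum_(J : {set 'I_b}) ((-1) ^+ odd #|J| * \prod_(l in J) s ^ w l) *: 'X^#|J|.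
  under eq_bigr do rewrite addrC.
  rewrite bigA_distr; apply: eq_bigr => J _.
  rewrite (bigID (mem J)) /= [X in _ * X]big1 ?mulr1; last by move=> l /negbTE ->.
  rewrite (eq_bigr (fun l => (- s ^ w l)%:P * 'X)); last first.
    by move=> l ->; rewrite -scaleNr mul_polyC.
  rewrite big_split /= prodr_const -rmorph_prod mul_polyC; congr (_ *: _).
  by rewrite prodrN signr_odd.
rewrite big_distrl /= coef_sum.
transitivity (\sum_(J : {set 'I_b})
    \sum_(al : {ffun 'I_a -> 'I_M} | (#|J| + mdeg (ffmon al) == i)%N)
    (-1) ^+ odd #|J| * s ^ mon_deg v w J (ffmon al)); last by rewrite pair_big_dep.
apply: eq_bigr => J _; rewrite big_distrr coef_sum [RHS]big_mkcond; apply: eq_bigr => al _ /=.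
rewrite -scalerAl -scalerAr -exprD scalerA coefZ coefXn eq_sym.
case: eqP => _; rewrite ?mulr0 // mulr1 -mulrA; congr (_ * _).
exact: mon_deg_expr.
Qed.

(** Under [phi] the factor [(1 - 'X) ^+ m] of [strand_poly] dies, and the shift [s ^+ c] is a
    unit. *)
Lemma koszul_prod_vanish M :
  (i < M)%N -> strands_balanced K m v w i -> (koszul_prod M)`_i = 0.
Proof.
move=> iM H; pose c := (\sum_l `|w l| + i * \sum_k `|v k|)%N.
have cP (J : {set 'I_b}) (mu : 'X_{1..a}) : (#|J| + mdeg mu)%N = i -> 0 <= mon_deg v w J mu + c%:Z.
  by move=> len; have := mon_deg_bound v w J mu; rewrite len -/c; lia.
have [Q QE] := strand_poly iM H cP.
rewrite coef_koszul_prod; apply: (mulIr (unitrX c sU)); rewrite mul0r big_distrl /=.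
have := congr1 phi QE; rewrite rmorphM rmorphXn rmorphB rmorph1 -/s s_nil mul0r => E0.
rewrite -[RHS]E0 rmorph_sum; apply: eq_bigr => p /eqP pi.
rewrite -mul_polyC rmorphM [phi 'X^_]rmorphXn -/s -mulrA; congr (_ * _).
  by rewrite polyC_exp rmorphXn /= polyCN polyC1 rmorphN rmorph1.
have := cP _ _ pi; rewrite /shdeg; move: (mon_deg _ _ _ _) => x xc.
rewrite -[s ^+ c]/(s ^ c%:Z) -exprzDr //; case: (x + c) xc => // n _.
Qed.
End KoszulFactor.

Section KoszulLeading.
Variables (K : numFieldType) (m a b : nat) (v : 'I_a -> int) (w : 'I_b -> int) (r : nat).

Lemma in_qpoly_eq0 (p : {poly K}) k : (k < m)%N -> in_qpoly 'X^m p = 0 -> p`_k = 0.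
Proof.
move=> km E; have m0 : (0 < m)%N by apply: leq_ltn_trans km.
have : Pdiv.CommonRing.rmodp p 'X^m = 0.
  move/(congr1 (fun x : {poly %/ 'X^m} => x : {poly K})): E.
  by rewrite /= mk_monic_Xn prednK.
move=> R0; rewrite (Pdiv.RingMonic.rdivp_eq (monicXn K m) p) R0 addr0 coefMXn km.
by [].
Qed.

Lemma koszul_leading (u : nat -> int) :
  (forall i, (r < i)%N -> strands_balanced K m v w i) ->
  u 0%N = 1 ->
  (forall i, (1 <= i <= r)%N -> (\prod_l (1 + w l *: 'X))`_i =
      \sum_(0 <= j < i.+1) (\prod_k (1 + v k *: 'X))`_j * u (i - j)%N) ->
  (forall j, (r < j)%N -> u j = 0) ->
  forall i, (r < i < m)%N -> (\prod_l (1 + w l *: 'X))`_i =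
      \sum_(0 <= j < i.+1) (\prod_k (1 + v k *: 'X))`_j * u (i - j)%N.
Proof.
move=> H u0 urec ubig i rim.
have m0 : (0 < m)%N by case/andP: rim => _; apply: leq_ltn_trans.
(* Divisibility by [(1 - s)^m] becomes vanishing in [B] for [s = 1 - tau]; as [s] is a unit there,
   negative degrees are allowed. *)
pose B := {poly %/ ('X^m : {poly K})}.
pose phi : {rmorphism {poly K} -> B} := in_qpoly 'X^m \o comp_poly (1 - 'X).
pose tau : B := in_qpoly 'X^m 'X.
have phiX : phi 'X = 1 - tau.
  by rewrite /phi /= comp_polyX rmorphB rmorph1.
have tau_nil : tau ^+ m = 0.
  rewrite /tau -rmorphXn /=; apply: val_inj; rewrite /= mk_monic_Xn prednK //.
  exact: Pdiv.RingMonic.rmodpp (monicXn K m).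
have sU : phi 'X \is a GRing.unit.
  rewrite phiX; apply/unitrPr; exists (\sum_(j < m) tau ^+ j).
  by rewrite -opprB mulNr -subrX1 tau_nil sub0r opprK.
have s_nil : (1 - phi 'X) ^+ m = 0 by rewrite phiX opprB addrC subrK.
have tau_free (x : int) k (c : B) : (k < m)%N -> x%:~R * tau ^+ k = c * tau ^+ k.+1 -> x = 0.
  move=> km E; pose q : {poly K} := x%:~R * 'X^k - (c : {poly K}) * 'X^(k.+1).
  have q0 : in_qpoly 'X^m q = 0.
    have cE : in_qpoly 'X^m (c : {poly K}) = c.
      by apply: val_inj; apply: in_qpoly_small; apply: size_mk_monic.
    by rewrite /q rmorphB !rmorphM !rmorphXn rmorph_int /= cE -/tau E subrr.
  move: (in_qpoly_eq0 km q0); rewrite /q coefB !coefMXn ltnn ltnSn subr0 subnn.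
  by rewrite -(rmorph_int polyC) coefC /= => /eqP; rewrite intr_eq0 => /eqP.
pose M := (b + a + r).+2.
pose ws := [seq w l | l <- enum 'I_b]; pose vs := [seq v k | k <- enum 'I_a].
have tU (x : int) : phi 'X ^ x \is a GRing.unit by rewrite unitrXz.
have fac : \prod_(l <- enum 'I_b) (1 - phi 'X ^ w l *: 'X) =
  \prod_(k <- enum 'I_a) (1 - phi 'X ^ v k *: 'X) * take_poly r.+1 (koszul_prod phi v w M).
  apply: geom_div.
  - by have [-> _] := size_prod_unit (enum 'I_b) (fun l => tU (w l)); rewrite size_enum_ord /M; lia.
  - by rewrite size_enum_ord /M; lia.
  - move=> j /andP[rj jM]; apply: (koszul_prod_vanish sU s_nil jM); exact: H.
have [Q sQ QE] := homz_factor (fun l => tU (w l)) (fun k => tU (v k)) fac (size_take_poly _ _).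
have prodE (n : nat) (f : 'I_n -> int) :
    \prod_k (1 + f k *: 'X) = \prod_(x <- [seq f k | k <- enum 'I_n]) (1 + x *: 'X) :> {poly int}.
  by rewrite big_map big_enum.
move: urec; rewrite !prodE => urec.
apply: (@leading_terms B tau m tau_free _ vs ws Q r) => //.
  by rewrite -phiX.
by rewrite /vs /ws (big_map w xpredT) (big_map v xpredT) -phiX QE.
Qed.
End KoszulLeading.

(** * Homotopies of the truncated complex *)

Section Nilpotent.
Variables (K : fieldType) (m : nat).
Local Notation S := {mpoly K[m]}.

Lemma degree_preserving_entry (e e' : seq int) (M : 'M[S]_(size e, size e')) :
  degree_preserving M ->
  forall k l mu, (M k l)@_mu != 0 -> (mdeg mu)%:Z = e`_k - e'`_l.
Proof.
move=> dM k l mu; have h0 d : homog_of_deg d (0 : S).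
  by case: d => [d|d] //=; exact: dhomog0.
have : homog_vec (e := e) e`_k (delta_mx 0 k : 'rV[S]_(size e)).
  move=> j; rewrite mxE eqxx /=; case: eqVneq => [->|_] //.
  by rewrite subrr; exact: dhomog1.
move/dM/(_ l); rewrite -rowE mxE; case: (e`_k - e'`_l) => d /=.
  by move=> hom nz; rewrite (dhomog_mf hom) // mcoeff_msupp.
by move=> ->; rewrite mcoeff0 eqxx.
Qed.

Definition degs_in (P : pred int) (e : seq int) (u : 'rV[S]_(size e)) : Prop :=
  forall k mu, (u 0 k)@_mu != 0 -> P ((mdeg mu)%:Z + e`_k).

Lemma degs_in0 P e : degs_in P (0 : 'rV[S]_(size e)).
Proof. by move=> k mu; rewrite mxE mcoeff0 eqxx. Qed.

Lemma degs_inD P e (u w : 'rV[S]_(size e)) : degs_in P u -> degs_in P w -> degs_in P (u + w).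
Proof.
move=> Hu Hw k mu; rewrite mxE mcoeffD; have [u0|/Hu//] := eqVneq (u 0 k)@_mu 0.
by rewrite u0 add0r; apply: Hw.
Qed.

Lemma degs_inN P e (u : 'rV[S]_(size e)) : degs_in P u -> degs_in P (- u).
Proof. by move=> Hu k mu; rewrite mxE mcoeffN oppr_eq0; apply: Hu. Qed.

Lemma degs_inM P (e e' : seq int) (M : 'M[S]_(size e, size e')) (u : 'rV[S]_(size e)) :
  degree_preserving M -> degs_in P u -> degs_in P (u *m M).
Proof.
move=> dM Hu l mu nz.
have [k nzk] : exists k, (u 0 k * M k l)@_mu != 0.
  apply: contrapT => /forallNP none; move: nz; rewrite mxE raddf_sum /= big1 ?eqxx // => k _.
  by apply/eqP/negPn/negP/none.
move: nzk; rewrite -mcoeff_msupp => /msuppM_le /allpairsP [[m1 m2] /= []].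
rewrite !mcoeff_msupp => /Hu P1 /(degree_preserving_entry dM) E2 ->.
by rewrite mdegD PoszD E2 addrA subrK.
Qed.

Lemma mpoly_split (P : pred 'X_{1..m}) (p : S) : exists p1 p2 : S, [/\ p = p1 + p2,
  forall mu, p1@_mu != 0 -> P mu & forall mu, p2@_mu != 0 -> ~~ P mu].
Proof.
have supp Q mu : (\sum_(nu <- msupp p | Q nu) p@_nu *: 'X_[nu])@_mu != 0 -> Q mu.
  apply: contraNT => nQ; rewrite raddf_sum /= big1 // => nu Qnu.
  by rewrite mcoeffZ mcoeffX; case: eqVneq Qnu nQ => [->->//|_ _ _]; rewrite mulr0.
exists (\sum_(nu <- msupp p | P nu) p@_nu *: 'X_[nu]).
exists (\sum_(nu <- msupp p | ~~ P nu) p@_nu *: 'X_[nu]); split; try exact: supp.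
by rewrite {1}[p]mpolyE (bigID P).
Qed.

Lemma degs_split (P : pred int) e (u : 'rV[S]_(size e)) : exists u1 u2 : 'rV[S]_(size e),
  [/\ u = u1 + u2, degs_in P u1 & degs_in (predC P) u2].
Proof.
have /choice [f fP] : forall k : 'I_(size e), exists p : S * S, [/\ u 0 k = p.1 + p.2,
    forall mu, p.1@_mu != 0 -> P ((mdeg mu)%:Z + e`_k) &
    forall mu, p.2@_mu != 0 -> ~~ P ((mdeg mu)%:Z + e`_k)].
  by move=> k; have [p1 [p2 ?]] := mpoly_split (fun mu => P ((mdeg mu)%:Z + e`_k)) (u 0 k);
    exists (p1, p2).
exists (\row_k (f k).1), (\row_k (f k).2); split.
- by apply/rowP => k; rewrite !mxE; case: (fP k).
- by move=> k mu; rewrite mxE; case: (fP k) => _ + _; apply.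
- by move=> k mu; rewrite mxE; case: (fP k) => _ _; apply.
Qed.

Lemma degs_in_disjoint P e (u : 'rV[S]_(size e)) :
  degs_in P u -> degs_in (predC P) u -> u = 0.
Proof.
move=> H H'; apply/rowP => k; rewrite mxE; apply/mpolyP => mu; rewrite mcoeff0.
by apply/eqP/negPn/negP => /[dup] /H + /H' /=; move=> ->.
Qed.

(* The chain condition is applied to the cycles that are boundaries up to degree [>= i]. *)
Lemma artinian_nilpotent (e1 e2 e3 : seq int) (M : 'M[S]_(size e1, size e2))
    (M' : 'M[S]_(size e2, size e3)) (k : 'I_m) (z : 'rV[S]_(size e2)) :
  degree_preserving M -> M *m M' = 0 -> artinian_homology M M' -> z *m M' = 0 ->
  exists N (y : 'rV[S]_(size e1)), 'X_k ^+ N *: z = y *m M.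
Proof.
move=> dM MM art z0.
pose N (i : nat) : set 'rV[S]_(size e2) := fun u =>
  u *m M' = 0 /\ exists b : 'rV_(size e1), degs_in (fun t => (i%:Z <= t)) (u - b *m M).
have memN i u : u \in mem (N i) <-> N i u by split=> [/set_mem|/mem_set].
have [i|i|i0 N0] := art N.
- split.
  + split; first by apply/memN; split;
      [rewrite mul0mx | exists 0; rewrite mul0mx subr0; exact: degs_in0].
    move=> c u w /memN[u0 [b Hb]] /memN[w0 [b' Hb']]; apply/memN; split.
      by rewrite mulmxDl -scalemxAl u0 w0 scaler0 addr0.
    exists (c *: b + b'); rewrite mulmxDl -scalemxAl opprD addrACA -scalerBr.
    apply: degs_inD => // j mu; rewrite mxE -mcoeff_msupp => /msuppM_le /allpairsP [[m1 m2] /= []].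
    rewrite !mcoeff_msupp => _ /Hb + ->; rewrite mdegD PoszD -addrA => h.
    by apply: le_trans h _; rewrite lerDr.
  + move=> _ [b _ <-]; split; first by rewrite -mulmxA MM mulmx0.
    by exists b; rewrite subrr; exact: degs_in0.
  + by move=> u [].
- move=> u [u0 [b Hb]]; split=> //; exists b => j mu /Hb.
  by apply: le_trans; rewrite lez_nat.
(* The sum compensates negative basis degrees, so ['X_k ^+ t *: z] lives in degrees at least
   [i0]. *)
pose t := (i0 + \sum_(j < size e2) `|(e2`_j)%R|)%N.
pose z' := 'X_k ^+ t *: z.
have leb (j : 'I_(size e2)) : (`|(e2`_j)%R| <= \sum_(j < size e2) `|(e2`_j)%R|)%N.
  by rewrite (bigD1 j) //= leq_addr.
have Nz' : N i0 z'.
  split; first by rewrite /z' -scalemxAl z0 scaler0.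
  exists 0; rewrite mul0mx subr0 => j mu; rewrite mxE -mcoeff_msupp => /msuppM_le.
  case/allpairsP => -[m1 m2] /= []; rewrite mpolyXn msuppX inE => /eqP -> _ ->.
  rewrite mdegD mdegMn mdeg1 mul1n /t; have := leb j.
  by set q := (\sum_(_ < _) _)%N; clearbody q; move: (e2`_j) (mdeg m2) => x y; lia.
(* Beyond every degree occurring in [z']. *)
pose i := (i0 + \sum_(j < size e2) (msize (z' 0%R j) + `|(e2`_j)%R|))%N.
have [_ [b Hb]] : N i z' by rewrite (N0 i) ?leq_addr.
(* [z' - b2 *m M] lies in degrees at least [i] by the choice of [b], and below [i] because [z'] and
   [b2] do; hence it is zero. *)
have [b1 [b2 [bE Hb1 Hb2]]] := degs_split (fun t => i%:Z <= t) b.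
exists t, b2; apply/eqP; rewrite -subr_eq0 -/z'; apply/eqP.
apply: (@degs_in_disjoint (fun t => i%:Z <= t)).
  have -> : z' - b2 *m M = (z' - b *m M) + b1 *m M.
    by rewrite bE mulmxDl opprD addrA addrAC subrK.
  by apply: degs_inD => //; apply: degs_inM.
apply: degs_inD; last by apply/degs_inN/degs_inM.
move=> j mu; rewrite -mcoeff_msupp => /msize_mdeg_lt lt; rewrite /= -ltNge.
have : (msize (z' 0%R j) + `|(e2`_j)%R| <= \sum_(j < size e2) (msize (z' 0%R j) + `|(e2`_j)%R|))%N.
  by rewrite (bigD1 j) //= leq_addr.
rewrite /i; move: lt; set q := (\sum_(j < _) _)%N; clearbody q.
by move: (e2`_j) (mdeg mu) (msize _) => x y u; lia.
Qed.

Lemma artinian_nilpotent_mx p (e1 e2 e3 : seq int) (M : 'M[S]_(size e1, size e2))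
    (M' : 'M[S]_(size e2, size e3)) (k : 'I_m) (Z : 'M[S]_(p, size e2)) :
  degree_preserving M -> M *m M' = 0 -> artinian_homology M M' -> Z *m M' = 0 ->
  exists N (Y : 'M[S]_(p, size e1)), 'X_k ^+ N *: Z = Y *m M.
Proof.
move=> dM MM art Z0.
have /choice [f fP] : forall i : 'I_p, exists Ny : nat * 'rV[S]_(size e1),
    'X_k ^+ Ny.1 *: row i Z = Ny.2 *m M.
  move=> i; have [|N [y E]] := artinian_nilpotent (z := row i Z) k dM MM art.
    by rewrite -row_mul Z0 row0.
  by exists (N, y).
pose N := (\sum_i (f i).1)%N.
have Nge i : ((f i).1 <= N)%N by rewrite /N (bigD1 i) //= leq_addr.
exists N, (\matrix_i ('X_k ^+ (N - (f i).1) *: (f i).2)).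
apply/row_matrixP => i; rewrite row_mul rowK -scalemxAl -fP scalerA -exprD subnK //.
by apply/rowP => j; rewrite !mxE.
Qed.

End Nilpotent.

Section Homotopy.
Variables (K : fieldType) (m n : nat) (T : graded_free_complex K m n).
Hypothesis art : homology_artinian T.
Local Notation S := {mpoly K[m]}.

Lemma dep_update (A : nat -> Type) (F : forall j, A j) t (x : A t) :
  exists F' : forall j, A j, F' t = x /\ forall j, j != t -> F' j = F j.
Proof.
exists (fun j => if t =P j is ReflectT e then ecast j (A j) e x else F j); split.
  by case: eqP => // e; rewrite (eq_irrelevance e (erefl t)).
by move=> j /eqP ne; case: eqP => // e; case: ne.
Qed.

(** Built from the right end, where all modules are zero, towards the left. Every extension costs a
    power of ['X_k], by which the maps already chosen are rescaled. *)
Lemma homotopy_exists (k : 'I_m) : exists N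
  (H : forall j, 'M[S]_(size (gdeg T j), size (fdeg T j)))
  (L : forall j, 'M[S]_(size (fdeg T j.+1), size (gdeg T j))), forall j,
    mapE T j *m L j + H j *m mapD T j = ('X_k ^+ N)%:M /\
    mapD T j.+1 *m H j.+1 + L j *m mapE T j = ('X_k ^+ N)%:M.
Proof.
suff Hyp t : (t <= n.+1)%N -> exists N
  (H : forall j, 'M[S]_(size (gdeg T j), size (fdeg T j)))
  (L : forall j, 'M[S]_(size (fdeg T j.+1), size (gdeg T j))), forall j, (n.+1 - t <= j)%N ->
    mapE T j *m L j + H j *m mapD T j = ('X_k ^+ N)%:M /\
    mapD T j.+1 *m H j.+1 + L j *m mapE T j = ('X_k ^+ N)%:M.
  have [N [H [L HL]]] := Hyp n.+1 (leqnn _); exists N, H, L => j.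
  by apply: HL; rewrite subnn.
elim: t => [|t IH] tn.
  exists 0%N, (fun=> 0), (fun=> 0) => j; rewrite subn0 => nj.
  have [f0 g0] : fdeg T j.+1 = [::] /\ gdeg T j = [::].
    split; first by case: (@complex_support _ _ _ T j.+1) => //; rewrite -ltnNge; exact: leqW.
    by case: (@complex_support _ _ _ T j) => //; apply/negP => /andP[_]; rewrite leqNgt nj.
  by split; apply/matrixP => x y; exfalso; move: (nat_of_ord x) (ltn_ord x) => x'; rewrite ?f0 ?g0.
have [N [H [L HL]]] := IH (ltnW tn).
set s := (n.+1 - t.+1)%N; have sE : (n.+1 - t = s.+1)%N by rewrite /s; lia.
rewrite sE in HL; set x := 'X_k in HL *.
have [EL _] := HL s.+1 (leqnn _).
(* The defect of the homotopy at [F_(s+1)] consists of cycles, so a power of [x] lifts it through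
   [mapE T s]; [Z2] does the same at [G_s]. *)
pose Z1 := (x ^+ N)%:M - mapD T s.+1 *m H s.+1.
have Z1D : Z1 *m mapD T s.+1 = 0.
  rewrite mulmxBl -mulmxA; have -> : H s.+1 *m mapD T s.+1 = (x ^+ N)%:M - mapE T s.+1 *m L s.+1.
    by rewrite -EL addrC addKr.
  by rewrite mulmxBr mulmxA mapDE mul0mx subr0 mul_scalar_mx mul_mx_scalar subrr.
have [N1 [Y1 E1]] := artinian_nilpotent_mx k (@mapE_degree _ _ _ T s)
  (mapED T s) (proj2 (art s)) Z1D.
rewrite -/x in E1.
pose Z2 := (x ^+ (N1 + N))%:M - mapE T s *m Y1.
have Z2E : Z2 *m mapE T s = 0.
  rewrite mulmxBl -mulmxA -E1 -scalemxAr /Z1 mulmxBr mulmxA mapED mul0mx subr0.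
  by rewrite mul_scalar_mx mul_mx_scalar scalerA -exprD subrr.
have [N2 [Y2 E2]] := artinian_nilpotent_mx k (@mapD_degree _ _ _ T s)
  (mapDE T s) (proj1 (art s)) Z2E.
rewrite -/x in E2.
have [H' [H's H'o]] := dep_update (fun j => x ^+ (N2 + N1) *: H j) Y2.
have [L' [L's L'o]] := dep_update (fun j => x ^+ (N2 + N1) *: L j) (x ^+ N2 *: Y1).
exists (N2 + N1 + N)%N, H', L' => j; rewrite leq_eqVlt => /predU1P[<-|sj].
  rewrite H's L's H'o ?gtn_eqF // -!scalemxAr -E2 /Z2; split.
    by rewrite scalerBr addrC subrK scale_scalar_mx -exprD addnA.
  rewrite -scalemxAl -E1 scalerA -exprD -scalerDr /Z1 addrC subrK.
  by rewrite scale_scalar_mx -exprD.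
have [EL' DH'] := HL j sj.
rewrite H'o ?L'o ?H'o ?gtn_eqF // ?(ltn_trans sj) // -!scalemxAr -!scalemxAl -!scalerDr EL' DH'.
by split; rewrite scale_scalar_mx -exprD.
Qed.
End Homotopy.

(** * Matrices of the truncated complex *)

Section NatEntries.
Variable S : comNzRingType.

(* Entries at natural numbers, [0] out of range: they make sense along equalities of degree
   sequences, without transport. *)
Definition mxn p r (A : 'M[S]_(p, r)) (k l : nat) : S :=
  match insub k, insub l with Some k', Some l' => A k' l' | _, _ => 0 end.

Lemma mxnE p r (A : 'M[S]_(p, r)) k l : mxn A (nat_of_ord k) (nat_of_ord l) = A k l.
Proof. by rewrite /mxn !valK. Qed.

Lemma mxnP p r (A : 'M[S]_(p, r)) k l :
  mxn A k l = 0 \/ exists (k' : 'I_p) (l' : 'I_r), [/\ k = k', l = l' & mxn A k l = A k' l'].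
Proof.
rewrite /mxn; case: insubP => [k' _ <-|_]; last by left.
by case: insubP => [l' _ <-|_]; [right; exists k', l' | left].
Qed.

Lemma mxn0 p r k l : mxn (0 : 'M[S]_(p, r)) k l = 0.
Proof. by case: (mxnP (0 : 'M_(p, r)) k l) => [//|[k' [l' [_ _ ->]]]]; rewrite mxE. Qed.

Lemma mxnD p r (A B : 'M[S]_(p, r)) k l : mxn (A + B) k l = mxn A k l + mxn B k l.
Proof.
rewrite /mxn; case: (insub k : option 'I_p) => [k'|]; case: (insub l : option 'I_r) => [l'|];
  by rewrite ?mxE ?addr0.
Qed.

Lemma mxnZ p r c (A : 'M[S]_(p, r)) k l : mxn (c *: A) k l = c * mxn A k l.
Proof.
rewrite /mxn; case: (insub k : option 'I_p) => [k'|]; case: (insub l : option 'I_r) => [l'|];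
  by rewrite ?mxE ?mulr0.
Qed.

Lemma mxnM p r n (A : 'M[S]_(p, r)) (B : 'M[S]_(r, n)) k l :
  mxn (A *m B) k l = \sum_(j < r) mxn A k j * mxn B j l.
Proof.
rewrite /mxn; case: (insub k : option 'I_p) => [k'|]; last first.
  by rewrite big1 // => j _; rewrite mul0r.
case: (insub l : option 'I_n) => [l'|]; last by rewrite big1 // => j _; rewrite valK mulr0.
by rewrite mxE; apply: eq_bigr => j _; rewrite valK.
Qed.

Lemma mxn_scalar p k l c : (k < p)%N -> mxn (c%:M : 'M[S]_p) k l = c *+ (k == l).
Proof.
move=> kp; rewrite -[k]/(nat_of_ord (Ordinal kp)) /mxn valK.
case: insubP => [l' _ <-|]; first by rewrite mxE.
by rewrite -leqNgt => pl; rewrite ltn_eqF // (leq_trans kp).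
Qed.

Definition mxf (I J : finType) (f : I -> J -> S) : 'M[S]_(#|I|, #|J|) :=
  \matrix_(i, j) f (enum_val i) (enum_val j).

Lemma mxfM (I J L : finType) (f : I -> J -> S) (g : J -> L -> S) :
  mxf f *m mxf g = mxf (fun x z => \sum_y f x y * g y z).
Proof.
apply/matrixP => i k; rewrite !mxE [RHS](reindex _ (onW_bij _ (@enum_val_bij J))).
by apply: eq_bigr => j _; rewrite !mxE.
Qed.

Lemma eq_mxf (I J : finType) (f g : I -> J -> S) : (forall x y, f x y = g x y) -> mxf f = mxf g.
Proof. by move=> fg; apply/matrixP => i j; rewrite !mxE. Qed.

Lemma mxfD (I J : finType) (f g : I -> J -> S) : mxf f + mxf g = mxf (fun x y => f x y + g x y).
Proof. by apply/matrixP => i j; rewrite !mxE. Qed.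

Lemma mxfZ (I J : finType) c (f : I -> J -> S) : c *: mxf f = mxf (fun x y => c * f x y).
Proof. by apply/matrixP => i j; rewrite !mxE. Qed.

Lemma mxf0 (I J : finType) : mxf (fun (_ : I) (_ : J) => 0) = 0.
Proof. by apply/matrixP => i j; rewrite !mxE. Qed.

Lemma mxf_scalar (I : finType) c : mxf (fun x y : I => c *+ (x == y)) = c%:M.
Proof. by apply/matrixP => i j; rewrite !mxE (inj_eq enum_val_inj). Qed.

Lemma big_tag q (s : nat -> nat) (j0 : nat) (F0 : nat -> S)
    (F : {j : 'I_q & 'I_(s j)} -> S) :
  (forall z, F z = if tag z == j0 :> nat then F0 (tagged z) else 0) ->
  \sum_z F z = if (j0 < q)%N then \sum_(l < s j0) F0 l else 0.
Proof.
move=> FE; rewrite (eq_bigr _ (fun z _ => FE z)).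
have -> : \sum_(z : {j : 'I_q & 'I_(s j)}) (if tag z == j0 :> nat then F0 (tagged z) else 0) =
    \sum_(j < q) \sum_(l < s j) (if j == j0 :> nat then F0 l else 0).
  by rewrite sig_big_dep.
case: ltnP => [jq|qj].
  rewrite (bigD1 (Ordinal jq)) //= eqxx [X in _ + X]big1 ?addr0 // => j ne.
  by rewrite big1 // => l _; rewrite (negbTE ne : (j == j0 :> nat) = false).
rewrite big1 // => j _; rewrite big1 // => l _.
by rewrite ltn_eqF // (leq_trans (ltn_ord j)).
Qed.
End NatEntries.

Section Assemble.
Variables (K : numFieldType) (m n : nat) (T : graded_free_complex K m n).
Hypothesis art : homology_artinian T.
Variables (q r : nat).
Hypothesis rE : r = frac_rank (mapE T q).
Local Notation S := {mpoly K[m]}.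

(** The index 0 contributes an empty fiber and keeps the numbering of the complex. *)
Definition fbasis : finType := {j : 'I_q.+1 & 'I_(size (fdeg T j))}.
Definition gbasis : finType := {j : 'I_q.+1 & 'I_(size (gdeg T j))}.
Definition fbasis_deg (x : fbasis) : int := (fdeg T (tag x))`_(tagged x).
Definition gbasis_deg (y : gbasis) : int := (gdeg T (tag y))`_(tagged y).
Definition truncD (x : fbasis) (y : gbasis) : S :=
  if tag y == tag x :> nat then mxn (mapD T (tag x)) (tagged x) (tagged y) else 0.
Definition truncE (y : gbasis) (x : fbasis) : S :=
  if tag x == (tag y).+1 :> nat then mxn (mapE T (tag y)) (tagged y) (tagged x) else 0.

Lemma fdeg0 : fdeg T 0 = [::].
Proof. by have [] := @complex_support _ _ _ T 0 isT. Qed.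
Lemma gdeg0 : gdeg T 0 = [::].
Proof. by have [] := @complex_support _ _ _ T 0 isT. Qed.

Lemma truncD_degree x y mu : (truncD x y)@_mu != 0 -> (mdeg mu)%:Z = fbasis_deg x - gbasis_deg y.
Proof.
rewrite /truncD; case: (tag y =P tag x :> nat) => [E|_]; last by rewrite mcoeff0 eqxx.
case: (mxnP (mapD T (tag x)) (tagged x) (tagged y)) => [->|[k [l [Ek El ->]]]].
  by rewrite mcoeff0 eqxx.
by move/(degree_preserving_entry (@mapD_degree _ _ _ T (tag x))) ->;
  rewrite /fbasis_deg /gbasis_deg Ek El E.
Qed.

Lemma truncE_degree y x mu : (truncE y x)@_mu != 0 -> (mdeg mu)%:Z = gbasis_deg y - fbasis_deg x.
Proof.
rewrite /truncE; case: (tag x =P (tag y).+1 :> nat) => [E|_]; last by rewrite mcoeff0 eqxx.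
case: (mxnP (mapE T (tag y)) (tagged y) (tagged x)) => [->|[k [l [Ek El ->]]]].
  by rewrite mcoeff0 eqxx.
by move/(degree_preserving_entry (@mapE_degree _ _ _ T (tag y))) ->;
  rewrite /fbasis_deg /gbasis_deg Ek El E.
Qed.

Lemma truncDE : mxf truncD *m mxf truncE = 0.
Proof.
rewrite mxfM -[RHS]mxf0; apply: eq_mxf => x x'; rewrite /truncD /truncE.
move: (ltn_ord (tag x)); move: (nat_of_ord (tag x)) (nat_of_ord (tagged x)) => j k jq.
move: (nat_of_ord (tag x')) (nat_of_ord (tagged x')) => j' k'.
rewrite (@big_tag _ _ (fun j => size (gdeg T j)) j
    (fun l => if j' == j.+1 then mxn (mapD T j) k l * mxn (mapE T j) l k' else 0)).
  by rewrite jq; case: eqP => _; [rewrite -mxnM mapDE mxn0 | rewrite big1].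
move=> z; move: (nat_of_ord (tag z)) (nat_of_ord (tagged z)) => jz l.
have [->|_] := eqVneq jz j; last by rewrite mul0r.
by case: eqP => _; rewrite ?mulr0.
Qed.

Lemma truncED : mxf truncE *m mxf truncD = 0.
Proof.
rewrite mxfM -[RHS]mxf0; apply: eq_mxf => y y'; rewrite /truncD /truncE.
move: (nat_of_ord (tag y)) (nat_of_ord (tagged y)) => j k.
move: (nat_of_ord (tag y')) (nat_of_ord (tagged y')) => j' k'.
rewrite (@big_tag _ _ (fun j => size (fdeg T j)) j.+1
    (fun l => if j' == j.+1 then mxn (mapE T j) k l * mxn (mapD T j.+1) l k' else 0)).
  by case: ifP => _ //; case: eqP => _; [rewrite -mxnM mapED mxn0 | rewrite big1].
move=> z; move: (nat_of_ord (tag z)) (nat_of_ord (tagged z)) => jz l.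
have [->|_] := eqVneq jz j.+1; last by rewrite mul0r.
by case: eqP => _; rewrite ?mulr0.
Qed.

Lemma tagged_eqE (s : nat -> nat) (x x' : {j : 'I_q.+1 & 'I_(s j)}) :
  (x == x') = (tag x' == tag x :> nat) && (nat_of_ord (tagged x) == tagged x').
Proof.
case: x x' => [j k] [j' k']; rewrite /= -tag_eqE /tag_eq /= [(j' == j :> nat)]eq_sym.
case: (j =P j') => [E|ne].
  by move: k'; rewrite -E => k'; rewrite eqxx tagged_asE.
by rewrite (_ : (nat_of_ord j == j') = false) //; apply/eqP => /val_inj.
Qed.

(** Truncation spoils the homotopy relation only at [G_q], where [E_q L_q] is missing; this is [P].
    The relation at [F_(q+1)] gives [E L E = x^N E], hence [P^2 = x^N P], and the rank is bounded
    because [P] factors through [E_q]. *)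
Lemma truncated_homotopy (k : 'I_m) :
  exists N (H : 'M_(#|gbasis|, #|fbasis|)) (L : 'M_(#|fbasis|, #|gbasis|)) (P : 'M[S]_#|gbasis|),
    [/\ mxf truncD *m H + L *m mxf truncE = ('X_k ^+ N)%:M,
      mxf truncE *m L + H *m mxf truncD = ('X_k ^+ N)%:M - P,
      mxf truncD *m P = 0 /\ P *m mxf truncE = 0 &
      P *m P = 'X_k ^+ N *: P /\ (frac_rank P <= r)%N].
Proof.
have [N [H [L HL]]] := homotopy_exists art k; set x_ := 'X_k ^+ N in HL *.
pose HH (y : gbasis) (x : fbasis) : S :=
  if tag x == tag y :> nat then mxn (H (tag y)) (tagged y) (tagged x) else 0.
pose LL (x : fbasis) (y : gbasis) : S :=
  if tag x == (tag y).+1 :> nat then mxn (L (tag y)) (tagged x) (tagged y) else 0.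
pose iota_ (y : gbasis) (l : 'I_(size (gdeg T q))) : S :=
  ((tag y == q :> nat) && (tagged y == l :> nat))%:R.
(* Selects the block of [G_q], so that [P] is a product of matrices containing [mapE T q] and rank
   inequalities apply. *)
pose A : 'M[S]_(#|gbasis|, size (gdeg T q)) := \matrix_(y, l) iota_ (enum_val y) l.
pose PP (y y' : gbasis) : S := if (tag y == q :> nat) && (tag y' == q :> nat) then
  mxn (mapE T q *m L q) (tagged y) (tagged y') else 0.
have sumA (F : nat -> S) (y : gbasis) : \sum_(l < size (gdeg T q)) iota_ y l * F l =
    if tag y == q :> nat then F (tagged y) else 0.
  rewrite /iota_; move: (ltn_ord (tagged y)).
  move: (nat_of_ord (tag y)) (nat_of_ord (tagged y)) => j k' lt.
  case: eqP lt => [->|_] lt; last by rewrite big1 // => l _; rewrite mul0r.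
  rewrite (bigD1 (Ordinal lt)) //= eqxx mul1r big1 ?addr0 // => l ne.
  rewrite [_ == _](_ : _ = false) ?mul0r //.
  by apply: contraNF ne => /eqP E'; apply/eqP/val_inj.
have PPA : mxf PP = A *m (mapE T q *m L q) *m A^T.
  apply/matrixP => i j; rewrite mxE /PP; set y := enum_val i; set y' := enum_val j.
  rewrite mxE; set M := mapE T q *m L q.
  rewrite (eq_bigr (fun l => iota_ y' l *
    (if tag y == q :> nat then mxn M (tagged y) l else 0))); last first.
    move=> l _; rewrite [A^T _ _]mxE [A j l]mxE -/y' mulrC; congr (_ * _).
    rewrite -(sumA (fun k => mxn M k l)) mxE; apply: eq_bigr => k' _.
    by rewrite mxE -/y mxnE.
  rewrite (sumA (fun l => if tag y == q :> nat then mxn M (tagged y) l else 0)).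
  by case: (nat_of_ord (tag y) == q); case: (nat_of_ord (tag y') == q).
have nE j : mapE T j *m L j + H j *m mapD T j = x_%:M by have [] := HL j.
have nD j : mapD T j.+1 *m H j.+1 + L j *m mapE T j = x_%:M by have [] := HL j.
have ELE : mapE T q *m L q *m mapE T q = x_ *: mapE T q.
  rewrite -mulmxA; have -> : L q *m mapE T q = x_%:M - mapD T q.+1 *m H q.+1.
    by have [_ <-] := HL q; rewrite addrC addKr.
  by rewrite mulmxBr mulmxA mapED mul0mx subr0 mul_mx_scalar.
exists N, (mxf HH), (mxf LL), (mxf PP); rewrite -/x_; split.
- rewrite !mxfM mxfD -mxf_scalar; apply: eq_mxf => x x'.
  rewrite (@tagged_eqE (fun j => size (fdeg T j)) x x') /truncD /truncE /HH /LL.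
  move: (ltn_ord (tag x)) (ltn_ord (tagged x)).
  move: (nat_of_ord (tag x)) (nat_of_ord (tagged x)) => j k' jq ks.
  move: (nat_of_ord (tag x')) (nat_of_ord (tagged x')) => j' l'.
  rewrite (@big_tag _ _ (fun j => size (gdeg T j)) j
      (fun l => if j' == j then mxn (mapD T j) k' l * mxn (H j) l l' else 0)); last first.
    move=> z; move: (nat_of_ord (tag z)) (nat_of_ord (tagged z)) => jz l.
    have [->|_] := eqVneq jz j; last by rewrite mul0r.
    by case: eqP => _; rewrite ?mulr0.
  (* The relation at [F_j] involves [L] at [j - 1]; [F_0] is zero. *)
  case: j jq ks => [|j] jq ks; first by exfalso; move: ks; rewrite fdeg0.
  rewrite (@big_tag _ _ (fun j => size (gdeg T j)) j
      (fun l => if j' == j.+1 then mxn (L j) k' l * mxn (mapE T j) l l' else 0)); last first.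
    move=> z; move: (nat_of_ord (tag z)) (nat_of_ord (tagged z)) => jz l.
    rewrite eqSS eq_sym; have [->|_] := eqVneq jz j; last by rewrite mul0r.
    by case: eqP => _; rewrite ?mulr0.
  rewrite jq (ltnW jq); have [_|_] := eqVneq j' j.+1; last by rewrite !big1 ?addr0.
  by rewrite -!mxnM -mxnD nD mxn_scalar.
- rewrite !mxfM mxfD -mxf_scalar -[X in _ - X]scale1r -scaleNr mxfZ mxfD.
  apply: eq_mxf => y y'.
  rewrite (@tagged_eqE (fun j => size (gdeg T j)) y y') /truncD /truncE /HH /LL /PP.
  move: (ltn_ord (tag y)) (ltn_ord (tagged y)).
  move: (nat_of_ord (tag y)) (nat_of_ord (tagged y)) => j k' jq ks.
  move: (nat_of_ord (tag y')) (nat_of_ord (tagged y')) => j' l'.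
  rewrite (@big_tag _ _ (fun j => size (fdeg T j)) j.+1
      (fun l => if j' == j then mxn (mapE T j) k' l * mxn (L j) l l' else 0)); last first.
    move=> z; move: (nat_of_ord (tag z)) (nat_of_ord (tagged z)) => jz l.
    have [->|_] := eqVneq jz j.+1; last by rewrite mul0r.
    by rewrite eqSS eq_sym; have [->|_] := eqVneq j' j; rewrite ?mulr0.
  rewrite (@big_tag _ _ (fun j => size (fdeg T j)) j
      (fun l => if j' == j then mxn (H j) k' l * mxn (mapD T j) l l' else 0)); last first.
    move=> z; move: (nat_of_ord (tag z)) (nat_of_ord (tagged z)) => jz l.
    have [->|_] := eqVneq jz j; last by rewrite mul0r.
    by case: eqP => _; rewrite ?mulr0.
  rewrite jq ltnS mulN1r; have [->|jj'] := eqVneq j' j; last first.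
    rewrite !big1 // if_same add0r /=; case: andP => [[/eqP jE /eqP j'E]|_]; last by rewrite subr0.
    by rewrite jE j'E eqxx in jj'.
  rewrite andbb -!mxnM -(mxn_scalar _ _ ks) -nE mxnD; have [jq'|qj] := ltnP j q.
    by rewrite (ltn_eqF jq') subr0.
  have -> : j = q by apply/eqP; rewrite eqn_leq qj -ltnS jq.
  by rewrite eqxx add0r addrAC subrr add0r.
- split; rewrite mxfM -[RHS]mxf0; apply: eq_mxf => x y'.
    rewrite /truncD /PP; move: (ltn_ord (tag x)).
    move: (nat_of_ord (tag x)) (nat_of_ord (tagged x)) => j k' jq.
    move: (nat_of_ord (tag y')) (nat_of_ord (tagged y')) => j' l'.
    rewrite (@big_tag _ _ (fun j => size (gdeg T j)) j (fun l => if (j == q) && (j' == q) then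
      mxn (mapD T j) k' l * mxn (mapE T q *m L q) l l' else 0)); last first.
      move=> z; move: (nat_of_ord (tag z)) (nat_of_ord (tagged z)) => jz l.
      have [->|_] := eqVneq jz j; last by rewrite mul0r.
      by case: andP => _; rewrite ?mulr0.
    rewrite jq; case: andP => [[/eqP -> _]|_]; last by rewrite big1.
    by rewrite -mxnM mulmxA mapDE mul0mx mxn0.
  rewrite big1 // => z _; rewrite /PP /truncE.
  case: andP => [[_ /eqP zq]|_]; last by rewrite mul0r.
  by rewrite [_ == _.+1]ltn_eqF ?mulr0 // zq; exact: (ltn_ord (tag y')).
split.
  rewrite mxfM mxfZ; apply: eq_mxf => y y'; rewrite /PP.
  move: (nat_of_ord (tag y)) (nat_of_ord (tagged y)) => j k'.
  move: (nat_of_ord (tag y')) (nat_of_ord (tagged y')) => j' l'.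
  rewrite (@big_tag _ _ (fun j => size (gdeg T j)) q (fun l => if (j == q) && (j' == q) then
    mxn (mapE T q *m L q) k' l * mxn (mapE T q *m L q) l l' else 0)); last first.
    move=> z; move: (nat_of_ord (tag z)) (nat_of_ord (tagged z)) => jz l.
    have [_|_] := eqVneq jz q; last by rewrite andbF mul0r.
    by case: eqP => _; case: eqP => _; rewrite ?mulr0 ?mul0r.
  rewrite ltnSn; case: andP => _; last by rewrite big1 // mulr0.
  by rewrite -mxnM -mxnZ mulmxA ELE scalemxAl.
rewrite /frac_rank PPA rE /frac_rank !map_mxM.
apply: leq_trans (mxrankM_maxl _ _) _; apply: leq_trans (mxrankM_maxr _ _) _.
exact: mxrankM_maxl.
Qed.
End Assemble.

Lemma sigmaE i (s : seq int) : sigma i s = (\prod_(x <- s) (1 + x *: 'X))`_i.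
Proof.
rewrite (big_nth 0) big_mkord; under eq_bigr do rewrite addrC.
rewrite bigA_distr coef_sum /sigma /mesym raddf_sum big_mkcond /=.
apply: eq_bigr => J _.
have -> : \prod_l (if l \in J then s`_l *: 'X else 1) =
    (\prod_(l in J) s`_l) *: 'X^#|J| :> {poly int}.
  rewrite -big_mkcond (eq_bigr (fun l : 'I_(size s) => (s`_l)%:P * 'X)); last first.
    by move=> l _; rewrite mul_polyC.
  by rewrite big_split /= prodr_const -rmorph_prod mul_polyC.
rewrite coefZ coefXn eq_sym; case: eqP => _; rewrite ?mulr0 // mulr1 rmorph_prod.
by apply: eq_bigr => l _; exact: mevalXU.
Qed.

Lemma prod_degs_upto (R : comNzRingType) (g : int -> R) (d : nat -> seq int) q : d 0%N = [::] ->
  \prod_(x <- flatten [seq d j | j <- iota 1 q]) g x =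
  \prod_(l < #|{: {j : 'I_q.+1 & 'I_(size (d j))}}|)
    g (d (tag (enum_val l)))`_(tagged (enum_val l)).
Proof.
move=> d0; rewrite big_flatten big_map.
pose F (x : {j : 'I_q.+1 & 'I_(size (d j))}) := g (d (tag x))`_(tagged x).
transitivity (\prod_x F x); last first.
  by rewrite (reindex _ (onW_bij _ (@enum_val_bij {: {j : 'I_q.+1 & 'I_(size (d j))}}))).
transitivity (\prod_(j < q.+1) \prod_(k < size (d j)) g (d j)`_k).
  rewrite -(big_mkord xpredT (fun j => \prod_(k < size (d j)) g (d j)`_k)) big_ltn //.
  rewrite d0 big_ord0 mul1r /index_iota subn1; apply: eq_bigr => j _.
  by rewrite (big_nth 0) big_mkord.
by rewrite sig_big_dep.
Qed.
Theorem theorem10 (R : realType) (m n : nat) (hm : (1 <= m)%N)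
    (Theta : graded_free_complex R[i] m n) (hart : homology_artinian Theta)
    (q : nat) (hq : (1 <= q <= n)%N) (r : nat)
    (hr : r = frac_rank (mapE Theta q)) (u : nat -> int) (u0 : u 0%N = 1)
    (urec : forall i, (1 <= i <= r)%N ->
       sigma i (gdegs_upto Theta q)
       = \sum_(0 <= j < i.+1) sigma j (fdegs_upto Theta q) * u (i - j)%N)
    (ubig : forall j, (r < j)%N -> u j = 0) :
  forall i, (r + 1 <= i <= m - 1)%N ->
    sigma i (gdegs_upto Theta q)
    = \sum_(0 <= j < i.+1) sigma j (fdegs_upto Theta q) * u (i - j)%N.
Proof.
move=> i hi.
have fE (j : nat) : sigma j (fdegs_upto Theta q) =
    (\prod_(k < #|fbasis Theta q|) (1 + fbasis_deg (enum_val k) *: 'X))`_j.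
  by rewrite sigmaE prod_degs_upto //; exact: fdeg0.
have gE (j : nat) : sigma j (gdegs_upto Theta q) =
    (\prod_(k < #|gbasis Theta q|) (1 + gbasis_deg (enum_val k) *: 'X))`_j.
  by rewrite sigmaE prod_degs_upto //; exact: gdeg0.
have sumE (j : nat) : \sum_(0 <= l < j.+1) sigma l (fdegs_upto Theta q) * u (j - l)%N =
    \sum_(0 <= l < j.+1) (\prod_(k < #|fbasis Theta q|) (1 + fbasis_deg (enum_val k) *: 'X))`_l *
      u (j - l)%N.
  by apply: eq_bigr => l _; rewrite fE.
rewrite gE sumE.
apply: (@koszul_leading R[i] m #|fbasis Theta q| #|gbasis Theta q|
  (fun k => fbasis_deg (enum_val k)) (fun l => gbasis_deg (enum_val l)) r u) => //.
- move=> j rj; apply: (@strands_balanced_gt R[i] m _ _ _ _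
    (mxf (@truncD _ m n Theta q)) (mxf (@truncE _ m n Theta q)) r j) => //.
  + by move=> k l mu; rewrite mxE; apply: truncD_degree.
  + by move=> k l mu; rewrite mxE; apply: truncE_degree.
  + exact: truncDE.
  + exact: truncED.
  + by move=> k; apply: truncated_homotopy.
- by move=> j jr; rewrite -gE urec // sumE.
- by lia.
Qed.
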